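(* Let $(\varepsilon_t)_{t\in\mathbb{Z}}$ be i.i.d. copies of a random variable $\varepsilon$, $Y$ measurable and $X_t=Y(\varepsilon_t,\varepsilon_{t-1},\dots)$. Fix $\tau\in(0,1)$ and suppose: (B) $F_X$ is Lipschitz continuous in a neighborhood of $\xi_0(\tau)$ and has a positive and continuous Lebesgue density at $\xi_0(\tau)$; (C) there exists $\delta>0$ such that $\sum_{t=0}^\infty\sup_{\xi\in\mathcal{X}_\tau(\delta)}\|1\{X_t<\xi\}-1\{X_t^*<\xi\}\|_2<\infty$. Let $w\in\mathcal{W}$ and let $B_n\to\infty$ with $B_n=o(\sqrt n)$. Then $$\sup_{\lambda\in(-\pi,\pi]}|\hat g_{n,\tau}(\lambda)-g_\tau(\lambda)|\to0\quad\text{in probability}.$$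
   Context: $\varepsilon_0^*$ is an independent copy of $\varepsilon_0$ (independent of $(\varepsilon_t)$) and $X_t^*=Y(\varepsilon_t,\dots,\varepsilon_1,\varepsilon_0^*,\varepsilon_{-1},\varepsilon_{-2},\dots)$. $\|Z\|_2=(\mathbb{E}|Z|^2)^{1/2}$. $F_X(x)=\mathbb{P}(X_0\le x)$, $\xi_0(\tau)=\inf\{x:F_X(x)\ge\tau\}$, $\mathcal{X}_\tau(\delta)=\{\xi:|\xi_0(\tau)-\xi|\le\delta\}$. $V_t(\tau,\xi)=\tau-1\{X_t<\xi\}$, $V_t(\tau)=V_t(\tau,\xi_0(\tau))$, $r_\tau(j)=\mathbb{E}V_0(\tau)V_j(\tau)$, $g_\tau(\lambda)=\frac{1}{2\pi}\sum_{j\in\mathbb{Z}}r_\tau(j)\cos(j\lambda)$. Given $X_1,\dots,X_n$: $\hat\xi_n(\tau)$ minimizes $\sum_{t=1}^n\rho_\tau(X_t-x)$, $\rho_\tau(x)=x(\tau-1\{x<0\})$; $\hat V_t(\tau)=V_t(\tau,\hat\xi_n(\tau))$; $\hat r_{n,\tau}(j)=n^{-1}\sum_{t=|j|+1}^n\hat V_t(\tau)\hat V_{t-|j|}(\tau)$ for $|j|<n$; $\hat g_{n,\tau}(\lambda)=\frac{1}{2\pi}\sum_{|j|<n}w(j/B_n)\hat r_{n,\tau}(j)\cos(j\lambda)$. $\mathcal{W}$ is the set of bounded continuous functions $w:\mathbb{R}\to\mathbb{R}$ with $w(x)=w(-x)$, $w(0)=1$, such that $\bar w(x)=\sup_{y\ge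 x}|w(y)|$ satisfies $\int_0^\infty\bar w(x)\,dx<\infty$ and $W(\lambda)=(2\pi)^{-1}\int_{-\infty}^\infty w(x)e^{-ix\lambda}dx$ satisfies $\int_{-\infty}^\infty|W(\lambda)|d\lambda<\infty$. *)

(* Defs.v *)
From HB Require Import structures.
From mathcomp Require Import all_boot all_order all_algebra.
From mathcomp Require Import all_classical all_reals all_analysis.
Set Implicit Arguments. Unset Strict Implicit. Unset Printing Implicit Defensive.
Import Order.TTheory GRing.Theory Num.Theory numFieldNormedType.Exports.
Local Open Scope classical_set_scope.
Local Open Scope ring_scope.

Definition cyl_sets d (E : measurableType d) : set (set (nat -> E)) :=
  [set S | exists (k : nat) (A : set E), measurable A /\ S = (fun f => f k) @^-1` A].

Definition seq_measurable d (R : realType) (E : measurableType d)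
    (Y : (nat -> E) -> R) : Prop :=
  forall B : set R, measurable B -> (<<s @cyl_sets _ E >>) (Y @^-1` B).

Definition mutually_independent d d' (T : measurableType d) (R : realType)
    (P : probability T R) (I : eqType) (E : measurableType d')
    (e : I -> T -> E) : Prop :=
  forall (s : seq I) (A : I -> set E), uniq s -> (forall i, measurable (A i)) ->
    P (\big[setI/setT]_(i <- s) (e i @^-1` A i)) =
    (\prod_(i <- s) P (e i @^-1` A i))%E.

Definition identically_distributed d d' (T : measurableType d) (R : realType)
    (P : probability T R) (I : Type) (E : measurableType d')
    (e : I -> T -> E) : Prop :=
  forall i j (A : set E), measurable A -> P (e i @^-1` A) = P (e j @^-1` A).

Definition ext_family (T E : Type) (eps : int -> T -> E) (eps0s : T -> E)
    : option int -> T -> E :=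
  fun o => match o with None => eps0s | Some t => eps t end.

Definition Xproc (T E : Type) (R : realType) (Y : (nat -> E) -> R)
    (eps : int -> T -> E) (t : int) : T -> R :=
  fun w => Y (fun k : nat => eps (t - k%:Z) w).

Definition Xstar (T E : Type) (R : realType) (Y : (nat -> E) -> R)
    (eps : int -> T -> E) (eps0s : T -> E) (t : nat) : T -> R :=
  fun w => Y (fun k : nat => if k == t then eps0s w else eps (t%:Z - k%:Z) w).

Definition ind01 (R : realType) (b : bool) : R := b%:R.

Definition L2nrm d (T : measurableType d) (R : realType) (P : probability T R)
    (Z : T -> R) : R :=
  Num.sqrt (fine (\int[P]_w ((`|Z w| ^+ 2)%:E))).

Definition expectR d (T : measurableType d) (R : realType) (P : probability T R)
    (Z : T -> R) : R := fine (\int[P]_w ((Z w)%:E)).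

Definition cdfX d (T : measurableType d) (R : realType) (P : probability T R)
    (X0 : T -> R) (x : R) : R := fine (P [set w | X0 w <= x]).

Definition quantile0 (R : realType) (F : R -> R) (tau : R) : R :=
  inf [set x | tau <= F x].

Definition Vt (T : Type) (R : realType) (X : int -> T -> R) (tau xi : R)
    (t : int) : T -> R :=
  fun w => tau - @ind01 R (X t w < xi).

Definition rtau d (T : measurableType d) (R : realType) (P : probability T R)
    (X : int -> T -> R) (tau xi0 : R) (j : int) : R :=
  expectR P (fun w => Vt X tau xi0 0 w * Vt X tau xi0 j w).

(* g_tau(lambda) = (2 pi)^{-1} sum_{j in Z} r_tau(j) cos(j lambda),
   the sum over Z being the limit of the symmetric partial sums *)
Definition gtau (R : realType) (r : int -> R) (lam : R) : R :=
  (2 * pi)^-1 * limn (fun N : nat =>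
     \sum_(k < N.*2.+1) r (k%:Z - N%:Z) * cos ((k%:Z - N%:Z)%:~R * lam)).

Definition rho_check (R : realType) (tau x : R) : R := x * (tau - @ind01 R (x < 0)).

Definition is_sample_quantile (T : Type) (R : realType) (X : int -> T -> R)
    (tau : R) (n : nat) (w : T) (x : R) : Prop :=
  forall y : R, \sum_(1 <= t < n.+1) rho_check tau (X t%:Z w - x)
             <= \sum_(1 <= t < n.+1) rho_check tau (X t%:Z w - y).

Definition rhat (T : Type) (R : realType) (X : int -> T -> R) (tau : R)
    (xihat : R) (n : nat) (w : T) (j : int) : R :=
  n%:R^-1 * \sum_((absz j).+1 <= t < n.+1)
     Vt X tau xihat t%:Z w * Vt X tau xihat (t%:Z - (absz j)%:Z) w.

Definition ghat (T : Type) (R : realType) (X : int -> T -> R) (tau : R)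
    (wk : R -> R) (Bn : R) (xihat : R) (n : nat) (w : T) (lam : R) : R :=
  (2 * pi)^-1 * \sum_(k < n.*2.-1)
     (let j := k%:Z - (n.-1)%:Z in
      wk (j%:~R / Bn) * rhat X tau xihat n w j * cos (j%:~R * lam)).

Definition wbar_w (R : realType) (w : R -> R) (x : R) : R :=
  sup [set `|w y| | y in [set y | x <= y]].

(* W(lambda) = (2pi)^{-1} int w(x) e^{-i x lambda} dx, real and imaginary parts *)
Definition W_re (R : realType) (w : R -> R) (lam : R) : R :=
  (2 * pi)^-1 * Rintegral (@lebesgue_measure R) setT (fun x => w x * cos (x * lam)).
Definition W_im (R : realType) (w : R -> R) (lam : R) : R :=
  - ((2 * pi)^-1 * Rintegral (@lebesgue_measure R) setT (fun x => w x * sin (x * lam))).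
Definition W_abs (R : realType) (w : R -> R) (lam : R) : R :=
  Num.sqrt (W_re w lam ^+ 2 + W_im w lam ^+ 2).

Definition in_W (R : realType) (w : R -> R) : Prop :=
  (exists M : R, forall x, `|w x| <= M) /\
  continuous w /\
  (forall x, w x = w (- x)) /\
  w 0 = 1 /\
  (@lebesgue_measure R).-integrable [set x | 0 <= x] (fun x => (wbar_w w x)%:E) /\
  (@lebesgue_measure R).-integrable setT (fun l => (W_abs w l)%:E).

(* Main.v *)
Require Import Defs.
From HB Require Import structures.
From mathcomp Require Import all_boot all_order all_algebra.
From mathcomp Require Import all_classical all_reals all_analysis.
From mathcomp Require Import measurable_realfun.
From mathcomp Require Import ring lra zify.
Set Implicit Arguments. Unset Strict Implicit. Unset Printing Implicit Defensive.
Import Order.TTheory GRing.Theory Num.Theory numFieldNormedType.Exports.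
Local Open Scope classical_set_scope.
Local Open Scope ring_scope.

(* The lag-window estimator at the true quantile differs from its mean by at
   most [sum_j |w(j/B)| |rhat(j) - E rhat(j)|], where the kernel sum is O(B)
   because [wbar] is nonincreasing and integrable, and where each deviation
   is O(1/sqrt n) in mean. The latter comes from a covariance inequality in
   the spirit of Efron-Stein: replacing the innovations one after the other
   by independent copies and exchanging each innovation with its copy gives
   [|Cov(f, g)| <= 1/2 sum_m D_m(f) D_m(g)], where [D_m] is the L2 change
   under replacement of the m-th innovation. Condition (C) makes these
   coefficients summable, which also yields [sum_j |r(j)| < oo], hence a
   vanishing bias by dominated convergence for series.

   Estimating the quantile costs little: as [1{x < xi}] is monotone in [xi],
   the autocovariances move by at most [2 |Fn(xihat-) - Fn(xi0-)|]. If
   [xihat >= xi0], then [Fn(xi0-) <= Fn(xihat-) <= tau]. Otherwise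
   [Fn(xihat-)] is bounded below through the barrier [y = xi0 - theta/B]: by
   the positive density [F(y)] lies below [tau] by at least [c theta/B],
   which exceeds the O(1/sqrt n) fluctuations of [Fn], so that [y <= xihat]
   with high probability, and by Lipschitz continuity [Fn(xi0-) - Fn(y-)] is
   at most [L theta/B] up to fluctuations. No bound on the number of ties at
   [xihat] is needed. *)

(** The innovations after time [N] form the independent copy, so the given sequence already contains
    all the randomness that is exchanged; [eps0s] enters only through the coefficients of (C).
    Stationarity and every exchange of innovations are injective reindexings of an i.i.d. family,
    which takes the place of conditional expectations throughout. The obstacle is that [Y] sees the
    whole past: after finitely many replacements the path is still not the independent copy. A
    good-sets argument shows that replacing all coordinates beyond a late one changes a bounded
    functional little in mean. Hence the covariance inequality appears with finite sums and an
    arbitrarily small error. The barrier sits at distance [theta / B] with [theta] fixed because the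
    quantile error is multiplied by a kernel sum of order [B]: the Lipschitz part becomes a multiple
    of [theta], small by choice, while the gap [c theta / B] dominates [1 / sqrt n] because
    [B = o(sqrt n)]. All fluctuations are gathered in one random variable of mean [O(B / sqrt n)],
    to which Markov's inequality applies. *)

(** * Bounded measurable functions *)

Section BoundedMeasurable.
Context {d : measure_display} {T : measurableType d} {R : realType}.
Implicit Types f g : T -> R.

(** Expectations below are taken of such functions: as [expectR] is the [fine] of an integral,
    boundedness is what secures its linearity. *)
Definition bmf f : Prop :=
  measurable_fun setT f /\ exists M : R, forall x, `|f x| <= M.

Lemma bmf_cst (c : R) : bmf (fun=> c).
Proof. by split; [exact: measurable_cst|exists `|c|]. Qed.

Lemma bmfD f g : bmf f -> bmf g -> bmf (fun x => f x + g x).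
Proof.
move=> [mf [M fM]] [mg [N gN]]; split; first exact: measurable_funD.
by exists (M + N) => x; rewrite (le_trans (ler_normD _ _))// lerD.
Qed.

Lemma bmfM f g : bmf f -> bmf g -> bmf (fun x => f x * g x).
Proof.
move=> [mf [M fM]] [mg [N gN]]; split; first exact: measurable_funM.
by exists (M * N) => x; rewrite normrM ler_pM.
Qed.

Lemma bmfZ (c : R) f : bmf f -> bmf (fun x => c * f x).
Proof. by move=> bf; apply: bmfM => //; exact: bmf_cst. Qed.

Lemma bmfN f : bmf f -> bmf (fun x => - f x).
Proof.
move=> /(bmfZ (-1)); congr bmf; apply/funext => x; exact: mulN1r.
Qed.

Lemma bmfB f g : bmf f -> bmf g -> bmf (fun x => f x - g x).
Proof. by move=> bf bg; apply: bmfD => //; exact: bmfN. Qed.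

Lemma bmfX f n : bmf f -> bmf (fun x => f x ^+ n).
Proof.
move=> bf; elim: n => [|n ih]; first exact: bmf_cst.
under [X in bmf X]funext => x do rewrite exprS.
exact: bmfM.
Qed.

Lemma bmf_norm f : bmf f -> bmf (fun x => `|f x|).
Proof.
move=> [mf [M fM]]; split; first exact: measurableT_comp.
by exists M => x; rewrite normr_id.
Qed.

Lemma bmf_sum (I : Type) (s : seq I) (p : pred I) (F : I -> T -> R) :
  (forall i, bmf (F i)) -> bmf (fun x => \sum_(i <- s | p i) F i x).
Proof.
move=> bF; elim: s => [|i s ih].
  by under [X in bmf X]funext => x do rewrite big_nil; exact: bmf_cst.
under [X in bmf X]funext => x do rewrite big_cons.
by case: (p i) => //; exact: bmfD.
Qed.

Lemma bmf_ind (b : T -> bool) : measurable_fun setT b -> bmf (fun x => (b x)%:R).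
Proof.
move=> mb; split.
  apply: (measurableT_comp (f := fun b : bool => b%:R : R)) => //.
by exists 1 => x; case: (b x); rewrite ?normr1 ?normr0.
Qed.

End BoundedMeasurable.

Lemma bmf_comp {d d'} {T : measurableType d} {U : measurableType d'}
    {R : realType} (f : U -> R) (phi : T -> U) :
  bmf f -> measurable_fun setT phi -> bmf (fun x => f (phi x)).
Proof.
move=> [mf [M fM]] mphi; split; first exact: measurableT_comp.
by exists M.
Qed.

(** * Expectation, Markov and Cauchy-Schwarz inequalities *)

Section Expectation.
Context {d : measure_display} {T : measurableType d} {R : realType}
  {P : probability T R}.
Implicit Types f g : T -> R.
Local Notation EP := (expectR P).

Lemma bmf_integrable f : bmf f -> P.-integrable setT (EFin \o f).
Proof.
move=> [mf [M fM]]; apply: measurable_bounded_integrable => //.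
  by rewrite (le_lt_trans (probability_le1 _ _))// ltry.
exists M; split; first exact: num_real.
by move=> x Mx y _ /=; rewrite (le_trans (fM y))// ltW.
Qed.

Lemma expectR_fineK f : bmf f -> (EP f)%:E = (\int[P]_w (f w)%:E)%E.
Proof.
move=> bf; rewrite /expectR fineK//; apply: integrable_fin_num => //.
exact: bmf_integrable.
Qed.

Lemma expectR_cst (c : R) : EP (fun=> c) = c.
Proof.
rewrite /expectR -[LHS]/(Rintegral P setT (fun=> c)) Rintegral_cst//.
by have /(congr1 fine)/= -> := @probability_setT _ _ _ P; rewrite mulr1.
Qed.

Lemma expectRD f g : bmf f -> bmf g -> EP (fun x => f x + g x) = EP f + EP g.
Proof. by move=> bf bg; apply: RintegralD => //; exact: bmf_integrable. Qed.

Lemma expectRB f g : bmf f -> bmf g -> EP (fun x => f x - g x) = EP f - EP g.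
Proof. by move=> bf bg; apply: RintegralB => //; exact: bmf_integrable. Qed.

Lemma expectRZ (c : R) f : bmf f -> EP (fun x => c * f x) = c * EP f.
Proof. by move=> bf; apply: RintegralZl => //; exact: bmf_integrable. Qed.

Lemma expectR_sum (I : Type) (s : seq I) (p : pred I) (F : I -> T -> R) :
  (forall i, bmf (F i)) ->
  EP (fun x => \sum_(i <- s | p i) F i x) = \sum_(i <- s | p i) EP (F i).
Proof.
move=> bF; elim: s => [|i s ih].
  under [X in EP X]funext => x do rewrite big_nil.
  by rewrite big_nil expectR_cst.
under [X in EP X]funext => x do rewrite big_cons.
rewrite big_cons; case: (p i) => //; rewrite expectRD// ?ih//.
exact: bmf_sum.
Qed.

Lemma ler_expectR f g : bmf f -> bmf g -> (forall x, f x <= g x) -> EP f <= EP g.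
Proof.
move=> bf bg fg; apply: le_Rintegral => //; exact: bmf_integrable.
Qed.

Lemma expectR_ge0 f : (forall x, 0 <= f x) -> 0 <= EP f.
Proof.
by move=> f0; apply/fine_ge0/integral_ge0 => x _; rewrite lee_fin.
Qed.

Lemma ler_norm_expectR f : bmf f -> `|EP f| <= EP (fun x => `|f x|).
Proof. by move=> bf; apply: le_normr_Rintegral => //; exact: bmf_integrable. Qed.

Lemma expectR_ind (A : set T) (b : T -> bool) : measurable A ->
  (forall x, b x <-> A x) -> EP (fun x => (b x)%:R) = fine (P A).
Proof.
move=> mA bA; rewrite /expectR; congr fine.
rewrite -[in RHS](setIT A) -integral_indic//; apply: eq_integral => x _.
rewrite indicE; congr ((nat_of_bool _)%:R%:E : \bar R).
by apply/idP/idP => [/bA|]; rewrite ?inE//; move=> /bA.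
Qed.

Lemma markov_expectR f (c : R) : bmf f -> (forall x, 0 <= f x) -> 0 < c ->
  (P [set x | (c <= f x)%R] <= (EP f / c)%:E)%E.
Proof.
move=> bf f0 c0.
have mS : measurable [set x | c <= f x].
  rewrite -[X in measurable X]setTI.
  have -> : [set x | c <= f x] = f @^-1` `[c, +oo[.
    by apply/seteqP; split => x /=; rewrite in_itv/= andbT.
  by case: bf => mf _; exact: mf.
have bI : bmf (fun x => (c <= f x)%R%:R : R).
  apply: bmf_ind; apply: measurable_fun_ler => //.
  by case: bf.
have := @expectR_ind _ (fun x => (c <= f x)%R) mS (fun x => iff_refl _).
move=> E1; rewrite -(fineK (fin_num_measure P _ mS)) -E1 lee_fin ler_pdivlMr//.
rewrite mulrC -expectRZ//; apply: ler_expectR => //; first exact: bmfZ.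
by move=> x; case: (boolP (c <= f x)) => [cf|_]; rewrite ?mulr1 ?mulr0.
Qed.

(** Integrating [2 p q <= u p^2 + q^2 / u] with [u = (b + e) / (a + e)] gives the bound
    [(a + e) * (b + e)]; the positive [e] covers vanishing [a] or [b] and then tends to zero. *)
Lemma cauchy_schwarz_expectR f g (a b : R) : bmf f -> bmf g -> 0 <= a -> 0 <= b ->
  EP (fun x => f x ^+ 2) <= a ^+ 2 -> EP (fun x => g x ^+ 2) <= b ^+ 2 ->
  `|EP (fun x => f x * g x)| <= a * b.
Proof.
move=> bf bg a0 b0 fa gb.
have key (e : R) : 0 < e -> `|EP (fun x => f x * g x)| <= (a + e) * (b + e).
  move=> e0; have ae : 0 < a + e by lra.
  have be : 0 < b + e by lra.
  set u := (b + e) / (a + e); have u0 : 0 < u by exact: divr_gt0.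
  apply: le_trans (ler_norm_expectR (bmfM bf bg)) _.
  have bh : bmf (fun x => 2^-1 * (u * f x ^+ 2 + u^-1 * g x ^+ 2)).
    by apply/bmfZ/bmfD; apply/bmfZ/bmfX.
  apply: (@le_trans _ _ (EP (fun x => 2^-1 * (u * f x ^+ 2 + u^-1 * g x ^+ 2)))).
    apply: ler_expectR => //; first exact/bmf_norm/bmfM.
    move=> x; rewrite normrM -(real_normK (num_real (f x))).
    rewrite -(real_normK (num_real (g x))).
    set p := `|f x|; set q := `|g x|.
    have : 0 <= (u * p - q) ^+ 2 / u by rewrite divr_ge0 ?sqr_ge0// ltW.
    have -> : (u * p - q) ^+ 2 / u = u * p ^+ 2 - 2 * (p * q) + u^-1 * q ^+ 2.
      by field; rewrite gt_eqF.
    lra.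
  rewrite expectRZ; last by apply: bmfD; apply/bmfZ/bmfX.
  rewrite expectRD ?expectRZ//; try exact: bmfX; try exact/bmfZ/bmfX.
  have h1 : u * EP (fun x => f x ^+ 2) <= u * (a + e) ^+ 2.
    by rewrite ler_pM2l// (le_trans fa)// lerXn2r ?nnegrE; lra.
  have h2 : u^-1 * EP (fun x => g x ^+ 2) <= u^-1 * (b + e) ^+ 2.
    by rewrite ler_pM2l ?invr_gt0// (le_trans gb)// lerXn2r ?nnegrE; lra.
  have h3 : u * (a + e) ^+ 2 = (a + e) * (b + e).
    by rewrite /u; field; rewrite gt_eqF.
  have h4 : u^-1 * (b + e) ^+ 2 = (a + e) * (b + e).
    by rewrite /u; field; rewrite !gt_eqF.
  lra.
apply/ler_addgt0Pr => e e0.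
(* As [t <= 1], [(a + t) * (b + t) <= a * b + c * t], and [c * t <= e]. *)
set c := a + b + 1; have c0 : 0 < c by rewrite /c; lra.
set t := Num.min 1 (e / c).
have t0 : 0 < t by rewrite lt_min ltr01 divr_gt0.
have t1 : t <= 1 by rewrite ge_min lexx.
have t2 : c * t <= e.
  by rewrite mulrC -ler_pdivlMr// /t ge_min lexx orbT.
apply: (le_trans (key t t0)); rewrite /c in t2; nra.
Qed.

Lemma expectR_norm_le f (a : R) : bmf f -> 0 <= a ->
  EP (fun x => f x ^+ 2) <= a ^+ 2 -> EP (fun x => `|f x|) <= a.
Proof.
move=> bf a0 fa; have := @cauchy_schwarz_expectR (fun x => `|f x|) (fun=> 1) a 1.
under [X in EP X <= a ^+ 2 -> _]funext => x do rewrite real_normK ?num_real//.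
move=> /(_ (bmf_norm bf) (bmf_cst _) a0 ler01 fa).
rewrite expr1n expectR_cst mulr1 => /(_ (lexx _)).
under [X in `|EP X|]funext => x do rewrite mulr1.
by apply: le_trans; exact: ler_norm.
Qed.

End Expectation.

(** * Path spaces with the product sigma-algebra *)

Definition cyl {dE} (J : Type) (E : measurableType dE) : set (set (J -> E)) :=
  [set S | exists (j : J) (A : set E), measurable A /\ S = (fun f => f j) @^-1` A].

(** For [J := nat] the generators are those of [seq_measurable]; paths indexed by [int],
    [option nat] and [bool * nat] occur as well. *)
Definition path {dE} (J : Type) (E : measurableType dE) :=
  g_sigma_algebraType (@cyl _ J E).

(** The pi-system on which laws are compared. Repetitions in [s] are allowed, so that an
    intersection is a concatenation; [finite_cyl_uniq] removes them where independence is
    applied. *)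
Definition finite_cyl {dE} (J : Type) (E : measurableType dE) : set (set (J -> E)) :=
  [set S | exists (s : seq J) (A : J -> set E), (forall j, measurable (A j)) /\
     S = \big[setI/setT]_(j <- s) ((fun f : J -> E => f j) @^-1` A j)].

Lemma big_setIP {T : Type} (J : eqType) (s : seq J) (A : J -> set T) (x : T) :
  (\big[setI/setT]_(j <- s) A j) x <-> (forall j, j \in s -> A j x).
Proof.
elim: s => [|i s ih]; first by rewrite big_nil.
rewrite big_cons; split => [[Ai /ih As] j|As].
  by rewrite inE => /predU1P[->|/As].
by split; [apply: As; rewrite mem_head|apply/ih => j js; apply: As; rewrite inE js orbT].
Qed.

Section Path.
Context {dE : measure_display} {E : measurableType dE}.

Lemma measurable_path {d} {T : measurableType d} (J : Type) (X : T -> path J E) :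
  (forall j, measurable_fun setT (fun w => X w j)) -> measurable_fun setT X.
Proof.
move=> mX; apply: (@measurability _ _ T (path J E) setT X (@cyl _ J E)) => //.
move=> _ [_ [j [A [mA ->]] <-]].
by rewrite setTI; have := mX j measurableT A mA; rewrite setTI.
Qed.

Lemma measurable_coord (J : Type) (j : J) :
  measurable_fun setT (fun y : path J E => y j).
Proof.
by move=> _ A mA; rewrite setTI; apply: sub_sigma_algebra; exists j, A.
Qed.

Lemma finite_cyl_setI (J : eqType) : setI_closed (@finite_cyl _ J E).
Proof.
move=> _ _ [s [A [mA ->]]] [t [B [mB ->]]].
pose C j := (if j \in s then A j else setT) `&` (if j \in t then B j else setT).
exists (s ++ t), C; split.
  by move=> j; apply: measurableI; case: ifP.
apply/seteqP; split => f.
  move=> [/big_setIP fA /big_setIP fB]; apply/big_setIP => j _.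
  by split; case: ifP => // js; [exact: fA|exact: fB].
move=> /big_setIP fC; split; apply/big_setIP => j js.
  by have := fC j; rewrite mem_cat js /C => /(_ isT)[]; rewrite js.
by have := fC j; rewrite mem_cat js orbT /C => /(_ isT)[_]; rewrite js.
Qed.

Lemma finite_cyl_measurable (J : eqType) (S : set (path J E)) :
  finite_cyl S -> measurable S.
Proof.
move=> [s [A [mA ->]]]; apply: bigsetI_measurable => j _.
by have := measurable_coord j measurableT (mA j); rewrite setTI.
Qed.

Lemma measurable_finite_cyl (J : eqType) :
  @measurable _ (path J E) = <<s @finite_cyl _ J E >>.
Proof.
apply/seteqP; split.
  apply: smallest_sub; first exact: smallest_sigma_algebra.
  move=> _ [j [A [mA ->]]]; apply: sub_sigma_algebra; exists [:: j], (fun=> A).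
  by split => //; rewrite big_seq1.
apply: smallest_sub; first exact: sigma_algebra_measurable.
by move=> S; exact: finite_cyl_measurable.
Qed.

Lemma path_measure_unique (R : realType) (J : eqType)
    (m1 m2 : {measure set (path J E) -> \bar R}) :
  (m1 setT < +oo)%E -> (forall S, finite_cyl S -> m1 S = m2 S) ->
  forall S, measurable S -> m1 S = m2 S.
Proof.
move=> m1T m12; apply: (@measure_unique _ _ (path J E) (@finite_cyl _ J E) (fun=> setT)) => //.
- exact: measurable_finite_cyl.
- exact: finite_cyl_setI.
- by move=> _; exists [::], (fun=> setT); rewrite big_nil.
- by rewrite bigcup_const//; exists 0%N.
Qed.

End Path.

(** * Laws, reindexing and independence for i.i.d. families *)

Section Iid.
Context {d : measure_display} {T : measurableType d} {R : realType}
  {P : probability T R} {dE : measure_display} {E : measurableType dE}.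
Local Notation EP := (expectR P).

Definition iid (J : eqType) (e : J -> T -> E) : Prop :=
  [/\ forall j, measurable_fun setT (e j), mutually_independent P e
    & identically_distributed P e].

Lemma iid_comp (I J : eqType) (e : I -> T -> E) (s : J -> I) :
  injective s -> iid e -> iid (fun j => e (s j)).
Proof.
move=> injs [me ie de]; split=> [j|l A ul mA|i j A mA]; [exact: me| |exact: de].
(* The events are carried along [s]; indices outside its range get the whole space. *)
pose A' i := if pselect (exists j, s j = i) is left H then A (sval (cid H)) else setT.
have A's j : A' (s j) = A j.
  rewrite /A'; case: pselect => [H|[]]; last by exists j.
  by congr A; apply: injs; case: (cid H).
have mA' i : measurable (A' i) by rewrite /A'; case: pselect.
have := ie (map s l) A'; rewrite map_inj_uniq// => /(_ ul mA').
rewrite !big_map.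
under eq_bigr do rewrite A's.
by under [in X in _ = X -> _]eq_bigr do rewrite A's.
Qed.

Lemma measurable_family (J : eqType) (e : J -> T -> E) :
  iid e -> measurable_fun setT ((fun w j => e j w) : T -> path J E).
Proof. by move=> [me _ _]; exact: measurable_path. Qed.

Lemma finite_cyl_uniq (J : eqType) (S : set (J -> E)) : finite_cyl S ->
  exists (s : seq J) (A : J -> set E), [/\ uniq s, forall j, measurable (A j) &
     S = \big[setI/setT]_(j <- s) ((fun f : J -> E => f j) @^-1` A j)].
Proof.
move=> [s [A [mA ->]]]; exists (undup s), A; split => //; first exact: undup_uniq.
by apply/seteqP; split => f /big_setIP fA; apply/big_setIP => j js; apply: fA;
  rewrite mem_undup in js *.
Qed.

Lemma preimage_cyl (J : Type) (X : T -> J -> E) (s : seq J) (A : J -> set E) :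
  X @^-1` (\big[setI/setT]_(j <- s) ((fun f : J -> E => f j) @^-1` A j)) =
  \big[setI/setT]_(j <- s) ((fun w => X w j) @^-1` A j).
Proof.
elim: s => [|j s ih]; first by rewrite !big_nil.
by rewrite !big_cons preimage_setI ih.
Qed.

(** Both joint laws factor on finite cylinders, where equal marginals make them agree. *)
Lemma iid_same_law (J : eqType) (e e' : J -> T -> E) : iid e -> iid e' ->
  (forall j A, measurable A -> P (e j @^-1` A) = P (e' j @^-1` A)) ->
  forall S : set (path J E), measurable S ->
    P ((fun w j => e j w) @^-1` S) = P ((fun w j => e' j w) @^-1` S).
Proof.
move=> ie ie' ee' S mS.
pose X : T -> path J E := fun w j => e j w.
pose X' : T -> path J E := fun w j => e' j w.
have mX : measurable_fun setT X := measurable_family ie.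
have mX' : measurable_fun setT X' := measurable_family ie'.
apply: (@path_measure_unique _ _ _ _ (pushforward P X) (pushforward P X')) => //.
  by rewrite /= /pushforward preimage_setT probability_setT ltry.
move=> C /finite_cyl_uniq[s [A [us mA ->]]].
rewrite /= /pushforward !preimage_cyl.
case: ie => _ ie _; case: ie' => _ ie' _.
rewrite (ie _ _ us mA) (ie' _ _ us mA).
by apply: eq_bigr => j _; rewrite ee'.
Qed.

Lemma iid_same_expectation (J : eqType) (e e' : J -> T -> E) (f : path J E -> R) :
  iid e -> iid e' ->
  (forall j A, measurable A -> P (e j @^-1` A) = P (e' j @^-1` A)) ->
  bmf f -> EP (fun w => f (fun j => e j w)) = EP (fun w => f (fun j => e' j w)).
Proof.
move=> ie ie' ee' bf.
pose X : T -> path J E := fun w j => e j w.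
pose X' : T -> path J E := fun w j => e' j w.
have mX : measurable_fun setT X := measurable_family ie.
have mX' : measurable_fun setT X' := measurable_family ie'.
have mf : measurable_fun setT (EFin \o f) by apply/measurable_EFinP; case: bf.
rewrite /expectR; congr fine.
have /= <- := @integral_pushforward _ _ T (path J E) R X mX P setT (EFin \o f) mf
  (bmf_integrable (bmf_comp bf mX)) measurableT.
have /= <- := @integral_pushforward _ _ T (path J E) R X' mX' P setT (EFin \o f) mf
  (bmf_integrable (bmf_comp bf mX')) measurableT.
apply: eq_measure_integral => S mS _.
exact: (@iid_same_law J e e' ie ie' ee' S mS).
Qed.

Lemma iid_marginal (J : eqType) (e : J -> T -> E) : iid e ->
  forall i j A, measurable A -> P (e i @^-1` A) = P (e j @^-1` A).
Proof. by move=> [_ _ h]. Qed.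

(** The tool behind stationarity, the exchange of an innovation with its copy, and the passage to
    [eps0s]: each is a choice of the two injections [s] and [t]. *)
Lemma iid_reindex (I J : eqType) (e : I -> T -> E) (s t : J -> I) (f : path J E -> R) :
  iid e -> injective s -> injective t -> bmf f ->
  EP (fun w => f (fun j => e (s j) w)) = EP (fun w => f (fun j => e (t j) w)).
Proof.
move=> ie injs injt bf; apply: iid_same_expectation => //; try exact: iid_comp.
by move=> j A mA; exact: iid_marginal.
Qed.

Lemma iid_indep_cyl (J : eqType) (e : bool * J -> T -> E) : iid e ->
  forall S S' : set (path J E), finite_cyl S -> finite_cyl S' ->
  P ((fun w j => e (false, j) w) @^-1` S `&` (fun w j => e (true, j) w) @^-1` S') =
  (P ((fun w j => e (false, j) w) @^-1` S) * P ((fun w j => e (true, j) w) @^-1` S'))%E.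
Proof.
move=> [me ie de] S S' /finite_cyl_uniq[s [A [us mA ->]]].
move=> /finite_cyl_uniq[s' [A' [us' mA' ->]]].
rewrite !preimage_cyl.
pose B (i : bool * J) := if i.1 then A' i.2 else A i.2.
have mB i : measurable (B i) by rewrite /B; case: ifP.
have injb b : injective (fun j : J => (b, j)) by move=> i j [].
have u1 : uniq [seq (false, j) | j <- s] by rewrite map_inj_uniq//; exact: injb.
have u2 : uniq [seq (true, j) | j <- s'] by rewrite map_inj_uniq//; exact: injb.
have u3 : uniq ([seq (false, j) | j <- s] ++ [seq (true, j) | j <- s']).
  rewrite cat_uniq u1 u2 andbT /= -all_predC all_map.
  by apply/allP => j js /=; apply/mapP => -[].
have E1 := ie _ B u1 mB; have E2 := ie _ B u2 mB; have E3 := ie _ B u3 mB.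
move: E1 E2 E3; rewrite !big_cat /= !big_map /B /=.
by move=> -> -> ->.
Qed.

(** Independence extends from cylinders in two passes of measure uniqueness, one event varying while
    the other is fixed. *)
Lemma iid_indep (J : eqType) (e : bool * J -> T -> E) : iid e ->
  forall S S' : set (path J E), measurable S -> measurable S' ->
  P ((fun w j => e (false, j) w) @^-1` S `&` (fun w j => e (true, j) w) @^-1` S') =
  (P ((fun w j => e (false, j) w) @^-1` S) * P ((fun w j => e (true, j) w) @^-1` S'))%E.
Proof.
move=> ie.
pose X b : T -> path J E := fun w j => e (b, j) w.
have mX b : measurable_fun setT (X b).
  by apply: measurable_family; apply: iid_comp => // i j [].
have mXS b S : measurable S -> measurable (X b @^-1` S).
  by move=> mS; rewrite -[X in measurable X]setTI; exact: mX.
have key b (D : set T) (mD : measurable D) :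
    (forall S, finite_cyl S -> P (X b @^-1` S `&` D) = (P (X b @^-1` S) * P D)%E) ->
    forall S, measurable S -> P (X b @^-1` S `&` D) = (P (X b @^-1` S) * P D)%E.
  move=> H S mS.
  have pD0 : 0 <= fine (P D) by exact: fine_ge0.
  pose r := NngNum pD0.
  have E0 C : (P C * P D = r%:num%:E * P C)%E.
    by rewrite /= fineK ?fin_num_measure// muleC.
  rewrite E0.
  (* For fixed [D] both sides are finite measures in [S]: a pushforward of [P] restricted to [D],
     and a pushforward scaled by the mass of [D]. *)
  apply: (@path_measure_unique _ _ _ _ (pushforward (mrestr P mD) (X b))
            (mscale r (pushforward P (X b)))) => //.
    rewrite /= /pushforward /mrestr preimage_setT setTI.
    by apply: le_lt_trans (probability_le1 _ mD) _; rewrite ltry.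
  move=> C fC; rewrite /= /pushforward /mrestr /mscale.
  by rewrite -[RHS]E0; exact: H.
move=> S S' mS mS'.
apply: (key false _ (mXS true _ mS') _ S mS) => C fC; rewrite setIC muleC.
apply: (key true _ (mXS false _ (finite_cyl_measurable fC)) _ S' mS') => C' fC'.
by rewrite setIC muleC; exact: iid_indep_cyl.
Qed.

(** By [iid_indep] the joint law of the two halves agrees with the product of their laws on
    rectangles, hence everywhere; Fubini's theorem separates the factors. *)
Lemma iid_expectM (J : eqType) (e : bool * J -> T -> E) (f g : path J E -> R) :
  iid e -> bmf f -> bmf g ->
  EP (fun w => f (fun j => e (false, j) w) * g (fun j => e (true, j) w)) =
  EP (fun w => f (fun j => e (false, j) w)) * EP (fun w => g (fun j => e (true, j) w)).
Proof.
move=> ie bf bg.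
pose X b : T -> path J E := fun w j => e (b, j) w.
have mX b : measurable_fun setT (X b).
  by apply: measurable_family; apply: iid_comp => // i j [].
have bfX b := bmf_comp bf (mX b); have bgX b := bmf_comp bg (mX b).
have mXX : measurable_fun setT (fun w => (X false w, X true w)).
  exact: measurable_fun_pair.
pose h (z : path J E * path J E) := f z.1 * g z.2.
have bh : bmf h.
  exact: (bmfM (bmf_comp bf measurable_fst) (bmf_comp bg measurable_snd)).
have mh : measurable_fun setT (EFin \o h) by apply/measurable_EFinP; case: bh.
pose m b : {mfun T >-> path J E} := mfun_Sub (mem_set (mX b)).
pose D b : probability (path J E) R := distribution P (m b).
have mE b S : D b S = P (X b @^-1` S) by [].
pose mm : {mfun T >-> (path J E * path J E)%type} := mfun_Sub (mem_set mXX).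
pose D2 : probability (path J E * path J E)%type R := distribution P mm.
have DD S : measurable S -> (D false \x D true)%E S = D2 S.
  apply: product_measure_unique => A B mA mB; exact: (iid_indep ie mA mB).
have iD2 : (\int[P]_w (h (X false w, X true w))%:E = \int[D2]_z (h z)%:E)%E.
  by have /= <- := integral_pushforward mXX mh
     (bmf_integrable (bmf_comp bh mXX)) measurableT.
rewrite {1}/expectR iD2.
have -> : (\int[D2]_z (h z)%:E = \int[(D false \x D true)%E]_z (h z)%:E)%E.
  by apply: eq_measure_integral => S mS _; exact/esym/DD.
rewrite -(@integral12_prod_meas1 _ _ _ _ _ (D false) (D true) (EFin \o h)) /=; last first.
  exact: bmf_integrable.
have ED b phi : bmf phi -> expectR (D b) phi = EP (fun w => phi (X b w)).
  move=> bphi; rewrite /expectR; congr fine.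
  apply: (integral_pushforward (mX b)) => //.
    by apply/measurable_EFinP; case: bphi.
  exact: (bmf_integrable (bmf_comp bphi (mX b))).
transitivity (expectR (D false) (fun x => expectR (D true) g * f x)).
  rewrite [RHS]/expectR; congr fine; apply: eq_integral => x _.
  rewrite /fubini_F /= /h /= -(expectR_fineK (bmfZ _ bg)) expectRZ//.
  by rewrite mulrC.
by rewrite expectRZ// !ED// mulrC.
Qed.


End Iid.

(** * The covariance inequality *)

Section CovarianceBound.
Context {d : measure_display} {T : measurableType d} {R : realType}
  {P : probability T R} {dE : measure_display} {E : measurableType dE}
  (e : bool * nat -> T -> E) (ie : iid (P := P) e).
Local Notation EP := (expectR P).

(* [mixed c] takes the coordinates in [c] from the independent copy. *)
Definition mixed (c : nat -> bool) : T -> path nat E := fun w k => e (c k, k) w.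

(** The deterministic map behind [mixed]: it turns expressions in several masks into one function of
    the doubled path, to which reindexing applies. *)
Definition select (c : nat -> bool) (y : path (bool * nat)%type E) : path nat E :=
  fun k => y (c k, k).

Local Notation none := (fun=> false).
Local Notation from m := (fun k => (m <= k)%N).
Local Notation only m := (fun k => k == m).

Lemma measurable_select c : measurable_fun setT (select c).
Proof.
by apply: (@measurable_path _ E _ (path (bool * nat)%type E)) => k; exact: measurable_coord.
Qed.

Lemma measurable_mixed c : measurable_fun setT (mixed c).
Proof. by apply: measurable_family; apply: iid_comp ie => i j []. Qed.

Lemma bmf_mixed c (f : path nat E -> R) : bmf f -> bmf (fun w => f (mixed c w)).
Proof. by move=> bf; apply: bmf_comp bf (measurable_mixed c). Qed.

(** Exchanging the coordinates marked by [a] with their copies permutes the doubled index set. *)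
Lemma expectR_flip (a : nat -> bool) (h : path (bool * nat)%type E -> R) :
  bmf h -> EP (fun w => h (e^~ w)) =
           EP (fun w => h (fun j => e (addb (a j.2) j.1, j.2) w)).
Proof.
move=> bh; apply: (iid_reindex (s := id) (t := fun j => (addb (a j.2) j.1, j.2)) ie) => //.
by move=> [b i] [b' i'] /= [+ ii]; rewrite ii => /addbI ->.
Qed.

Lemma mixed_law c (f : path nat E -> R) : bmf f ->
  EP (fun w => f (mixed c w)) = EP (fun w => f (mixed none w)).
Proof.
move=> bf; apply: (iid_reindex (s := fun k => (c k, k)) (t := fun k => (false, k)) ie) => //.
- by move=> i j [].
- by move=> i j [].
Qed.

Lemma mixed_lawP c (S : set (path nat E)) : measurable S ->
  P (mixed c @^-1` S) = P (mixed none @^-1` S).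
Proof.
move=> mS.
apply: (@iid_same_law _ _ _ _ _ _ _ (fun k => e (c k, k)) (fun k => e (false, k))) => //.
- by apply: iid_comp ie => i j [].
- by apply: iid_comp ie => i j [].
- by move=> k A mA; exact: (iid_marginal ie).
Qed.

Let mpre c (S : set (path nat E)) : measurable S -> measurable (mixed c @^-1` S).
Proof. by move=> mS; rewrite -[X in measurable X]setTI; exact: measurable_mixed. Qed.

(** Membership in [S] is nearly decided by finitely many coordinates. Testing this on the mixed path
    avoids choosing an approximating cylinder; leaving instead of entering [S] is the same property
    of the complement. *)
Definition tail_negligible (S : set (path nat E)) : Prop :=
  forall r : R, 0 < r -> exists M0 : nat, forall M : nat, (M0 <= M)%N ->
    (P (mixed none @^-1` S `&` mixed (from M) @^-1` (~` S)) <= r%:E)%E.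

Lemma tail_negligible_sub (S A B : set (path nat E)) :
  measurable S -> measurable A -> measurable B ->
  tail_negligible A -> tail_negligible B ->
  (forall x y, S x -> ~ S y -> (A x /\ ~ A y) \/ (B x /\ ~ B y)) ->
  tail_negligible S.
Proof.
move=> mS mA mB tA tB H r r0.
have r2 : 0 < r / 2 by rewrite divr_gt0.
have [M1 h1] := tA _ r2; have [M2 h2] := tB _ r2.
exists (maxn M1 M2) => M; rewrite geq_max => /andP[/h1 {}h1 /h2 {}h2].
rewrite (splitr r) EFinD; apply: le_trans (leeD h1 h2).
have mI C : measurable C ->
    measurable (mixed none @^-1` C `&` mixed (from M) @^-1` (~` C)).
  by move=> mC; apply: measurableI; apply: mpre => //; exact: measurableC.
apply: le_trans (measureU2 _ (mI _ mA) (mI _ mB)).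
apply: le_measure; rewrite ?inE; [exact: mI|apply: measurableU; exact: mI|].
by move=> w [/= Sx Sy]; case: (H _ _ Sx Sy) => -[? ?]; [left|right].
Qed.

(** Complements are built into the class. A countable union is replaced by a finite union [U K], at
    the cost of the event that the path lies in the remainder [V K], which decreases to the empty
    set. *)
Lemma tail_negligible_sigma :
  sigma_algebra setT [set S : set (path nat E) |
    [/\ measurable S, tail_negligible S & tail_negligible (~` S)]].
Proof.
have t0 : tail_negligible set0.
  by move=> r r0; exists 0%N => M _; rewrite preimage_set0 set0I measure0 lee_fin ltW.
have tT : tail_negligible (~` set0).
  move=> r r0; exists 0%N => M _.
  by rewrite setCK preimage_set0 setI0 measure0 lee_fin ltW.
split=> /=.
- by split.
- by move=> S [mS tS tCS]; rewrite setTD setCK; split => //; exact: measurableC.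
move=> S hS; have mS i : measurable (S i) by case: (hS i).
pose U K := \big[setU/set0]_(i < K) S i.
have mU K : measurable (U K) by apply: bigsetU_measurable.
have mbS : measurable (\bigcup_i S i) by exact: bigcup_measurable.
have hU K : tail_negligible (U K) /\ tail_negligible (~` (U K)).
  elim: K => [|K [ih1 ih2]]; first by rewrite /U big_ord0.
  have UE : U K.+1 = U K `|` S K by rewrite /U big_ord_recr.
  have [_ t1 t2] := hS K; split; rewrite UE.
    apply: (tail_negligible_sub _ (mU K) (mS K) ih1 t1); first exact: measurableU.
    by move=> x y [Ux|Sx] /not_orP[nU nS]; [left|right].
  have mC := fun K => measurableC (mU K).
  apply: (tail_negligible_sub _ (mC K) (measurableC (mS K)) ih2 t2).
    by apply: measurableC; exact: measurableU.
  move=> x y /not_orP[nU nS] /contrapT[Uy|Sy]; [left|right]; split => //; exact.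
pose V K := (\bigcup_i S i) `\` U K.
have mV K : measurable (V K) by exact: measurableD.
have Vsmall (r : R) : 0 < r -> exists K, (P (mixed none @^-1` V K) <= r%:E)%E.
  move=> r0.
  have ndV m n : (m <= n)%N -> V n `<=` V m.
    move=> mn y [Sy nUy]; split => // Uy; apply: nUy.
    move: Uy; rewrite /U -!bigcup_mkord => -[i im Si]; exists i => //=.
    exact: leq_trans im mn.
  have : (P (mixed none @^-1` V n)) @[n --> \oo] --> P set0.
    have -> : set0 = \bigcap_n mixed none @^-1` V n.
      apply/esym; rewrite -subset0 => w Vw.
      have [[i _ Si] _] := Vw 0%N I.
      have [_] := Vw i.+1 I; apply.
      by rewrite /U big_ord_recr; right.
    apply: nonincreasing_cvg_mu.
    - by apply: le_lt_trans (probability_le1 _ (mpre _ (mV 0%N))) _; rewrite ltry.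
    - by move=> n; exact: mpre.
    - by apply: bigcap_measurable => // n _; exact: mpre.
    - by move=> m n mn; apply/subsetPset => w; exact: ndV.
  rewrite measure0 => /fine_cvgP[_ /cvgrPdist_lt /(_ r r0)] [K _ hK].
  exists K; have /= := hK K (leqnn K); rewrite sub0r normrN => hr.
  rewrite -(fineK (fin_num_measure P _ (mpre _ (mV K)))) lee_fin ltW//.
  by apply: le_lt_trans hr; exact: ler_norm.
have mXC c K C D : measurable C -> measurable D ->
    measurable (mixed c @^-1` C `&` mixed K @^-1` D).
  by move=> mC mD; apply: measurableI; exact: mpre.
split => // r r0; have r2 : 0 < r / 2 by rewrite divr_gt0.
- have [K hK] := Vsmall _ r2; have [M0 hM] := (hU K).1 _ r2.
  exists M0 => M /hM {}hM; rewrite (splitr r) EFinD; apply: le_trans (leeD hM hK).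
  have m1 := mXC none (from M) _ _ (mU K) (measurableC (mU K)).
  apply: le_trans (measureU2 _ m1 (mpre none (mV K))).
  apply: le_measure; rewrite ?inE.
  + by apply: mXC => //; exact: measurableC.
  + by apply: measurableU => //; exact: mpre.
  move=> w [/= Sx nSy].
  have [Ux|nUx] := pselect (U K (mixed none w)); last by right.
  left; split => //= Uy; apply: nSy.
  by move: Uy; rewrite /U -bigcup_mkord => -[i _ Si]; exists i.
- have [K hK] := Vsmall _ r2; have [M0 hM] := (hU K).2 _ r2.
  exists M0 => M /hM {}hM; rewrite (splitr r) EFinD.
  (* Here it is the mixed path that may fall into the remainder; its law is that of the original
     path, uniformly in [M]. *)
  rewrite -(mixed_lawP (from M) (mV K)) in hK; apply: le_trans (leeD hM hK).
  have m1 := mXC none (from M) _ _ (measurableC (mU K)) (measurableC (measurableC (mU K))).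
  apply: le_trans (measureU2 _ m1 (mpre (from M) (mV K))).
  apply: le_measure; rewrite ?inE.
  + by apply: mXC => //; rewrite ?setCK//; exact: measurableC.
  + by apply: measurableU => //; exact: mpre.
  move=> w [/= nSx /contrapT Sy].
  have [Uy|nUy] := pselect (U K (mixed (from M) w)); last by right.
  left; split; last by move=> nU; exact: (nU Uy).
  move=> Ux; apply: nSx.
  by move: Ux; rewrite /U -bigcup_mkord => -[i _ Si]; exists i.
Qed.

Lemma tail_negligibleP (S : set (path nat E)) :
  measurable S -> tail_negligible S.
Proof.
move=> mS.
suff : [set S : set (path nat E) |
    [/\ measurable S, tail_negligible S & tail_negligible (~` S)]] S by case.
move: S mS; apply: smallest_sub; first exact: tail_negligible_sigma.
move=> _ [k [A [mA ->]]] /=.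
have H (C : set E) : tail_negligible ((fun f : path nat E => f k) @^-1` C).
  (* Once [k < M], coordinate [k] is kept and the event is empty. *)
  move=> r r0; exists k.+1 => M kM.
  rewrite (_ : _ `&` _ = set0) ?measure0 ?lee_fin ?ltW//.
  rewrite -subset0 => w [/= Cw]; apply.
  by move: Cw; rewrite /mixed leqNgt kM.
split => //; first by have := measurable_coord k measurableT mA; rewrite setTI.
exact: (H (~` A)).
Qed.

Lemma measurable_truncn : measurable_fun setT (fun x : R => Num.truncn x).
Proof.
move=> _ A mA; rewrite setTI.
have -> : (fun x : R => Num.truncn x) @^-1` A =
    \bigcup_(i in A) (fun x : R => Num.truncn x) @^-1` [set i].
  by apply/seteqP; split => x /=; [exists (Num.truncn x)|move=> [i Ai /= ->]].
have mle n : measurable [set x : R | (Num.truncn x <= n)%N].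
  rewrite (_ : [set _ | _] = `]-oo, n.+1%:R[%classic); first exact: measurable_itv.
  by apply/seteqP; split => x /=; rewrite in_itv/= truncn_le_nat.
apply: bigcup_measurable => -[|i] _.
  rewrite (_ : _ @^-1` _ = [set x : R | (Num.truncn x <= 0)%N]); first exact: mle.
  by apply/seteqP; split => x /=; rewrite leqn0 => /eqP.
rewrite (_ : _ @^-1` _ = [set x : R | (Num.truncn x <= i.+1)%N] `\`
                         [set x : R | (Num.truncn x <= i)%N]); first exact: measurableD.
apply/seteqP; split => x /=; first by move=> ->; rewrite ltnn.
by move=> [h1 /negP]; rewrite -ltnNge => h2; apply/eqP; rewrite eqn_leq h1.
Qed.

(** The range of [f] is cut into cells of width [q = r / 2], [N] of them. Within one cell values
    differ by at most [q]; otherwise by at most [2 * K], an event whose probability is controlled by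
    tail negligibility of each cell. *)
Lemma tail_L1 (f : path nat E -> R) : bmf f -> forall r : R, 0 < r ->
  exists M0 : nat, forall M, (M0 <= M)%N ->
    EP (fun w => `|f (mixed none w) - f (mixed (from M) w)|) <= r.
Proof.
move=> bf r r0; have [mf [K0 fK0]] := bf.
pose K := `|K0| + 1.
have K0' : 0 < K by rewrite /K ltr_wpDl.
have fK y : `|f y| < K.
  by apply: le_lt_trans (fK0 y) _; rewrite /K; apply: le_lt_trans (ler_norm _) _; rewrite ltrDl.
pose q := r / 2; have q0 : 0 < q by rewrite divr_gt0.
pose N := (Num.truncn (2 * K / q)).+1.
pose cell y := Num.truncn ((f y + K) / q).
have cellN y : (cell y < N)%N.
  rewrite ltnS; apply: le_truncn; rewrite ler_pM2r ?invr_gt0//.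
  by have := fK y; rewrite ltr_norml => /andP[_ ?]; lra.
have cell_close x y : cell x = cell y -> `|f x - f y| <= q.
  move=> xy.
  have pos z : 0 <= (f z + K) / q.
    by rewrite divr_ge0 ?(ltW q0)//; have := fK z; rewrite ltr_norml => /andP[? _]; lra.
  have /andP[x1 x2] := truncn_itv (pos x); have /andP[y1 y2] := truncn_itv (pos y).
  have : `|(f x + K) / q - (f y + K) / q| <= 1.
    move: x1 x2 y1 y2; rewrite -/(cell x) -/(cell y) xy -natr1 => ? ? ? ?.
    by rewrite ler_norml; apply/andP; split; lra.
  rewrite -mulrBl normrM normfV (gtr0_norm q0) ler_pdivrMr// mul1r.
  by congr (`|_| <= _); ring.
pose S (i : nat) := cell @^-1` [set i].
have mcell : measurable_fun setT (cell : path nat E -> nat).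
  apply: (measurableT_comp measurable_truncn).
  by apply: measurable_funM => //; apply: measurable_funD.
have mS i : measurable (S i) by rewrite -[X in measurable X]setTI; exact: mcell.
(* Each cell contributes probability at most [s], and [2 * K * N * s] equals [q]. *)
pose s := q / (2 * K * N%:R).
have s0 : 0 < s by rewrite !(divr_gt0, mulr_gt0)// ltr0n.
have [M0 hM0] : exists M0 : nat, forall M, (M0 <= M)%N -> forall i, (i < N)%N ->
   (P (mixed none @^-1` S i `&` mixed (from M) @^-1` (~` S i)) <= s%:E)%E.
  elim: N {s s0 cellN} (s) (s0) => [|n ih] s s0; first by exists 0%N.
  have [M1 h1] := ih s s0; have [M2 h2] := tail_negligibleP (mS n) s0.
  exists (maxn M1 M2) => M; rewrite geq_max => /andP[/h1 {}h1 /h2 {}h2] i.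
  by rewrite ltnS leq_eqVlt => /predU1P[->//|]; exact: h1.
exists M0 => M /hM0 {}hM0.
pose b i w := (cell (mixed none w) == i) && (cell (mixed (from M) w) != i).
have mb i : measurable_fun setT (b i).
  apply: measurable_and; last apply: measurable_neg.
    by apply: measurable_fun_eqn => //; exact: (measurableT_comp mcell (measurable_mixed _)).
  by apply: measurable_fun_eqn => //; exact: (measurableT_comp mcell (measurable_mixed _)).
have bb i : bmf (fun w => (b i w)%:R : R) by exact: bmf_ind.
apply: (@le_trans _ _ (EP (fun w => q + 2 * K * \sum_(i < N) (b i w)%:R))).
  apply: ler_expectR.
  - by apply: bmf_norm; apply: bmfB; exact: bmf_mixed.
  - by apply: bmfD; [exact: bmf_cst|apply: bmfZ; apply: bmf_sum].
  move=> w; set x := mixed none w; set y := mixed _ w.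
  have [xy|xy] := eqVneq (cell x) (cell y).
    apply: le_trans (cell_close _ _ xy) _; rewrite lerDl mulr_ge0//.
      by rewrite mulr_ge0// ltW.
    by apply: sumr_ge0.
  have -> : \sum_(i < N) (b i w)%:R = 1 :> R.
    rewrite (bigD1 (Ordinal (cellN x)))//= big1 ?addr0.
      by rewrite /b eqxx /= eq_sym xy.
    move=> i /eqP ix; rewrite /b; case: eqP => //= xi.
    by exfalso; apply: ix; apply: val_inj.
  have := ler_normB (f x) (f y); have := fK x; have := fK y; lra.
rewrite expectRD ?expectR_cst; [|exact: bmf_cst|by apply: bmfZ; exact: bmf_sum].
rewrite expectRZ ?expectR_sum//; last exact: bmf_sum.
have hb (i : 'I_N) : EP (fun w => (b i w)%:R) <= s.
  have mI : measurable (mixed none @^-1` S i `&` mixed (from M) @^-1` (~` S i)).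
    by apply: measurableI; apply: mpre => //; exact: measurableC.
  rewrite (expectR_ind mI); last first.
    by move=> w; split => [/andP[/eqP ? /eqP ?]|[/= ? ?]]; [split|apply/andP; split; exact/eqP].
  by rewrite -lee_fin fineK ?fin_num_measure//; exact: hM0.
have : \sum_(i < N) EP (fun w => (b i w)%:R) <= \sum_(i < N) s by exact: ler_sum.
rewrite sumr_const card_ord -mulr_natr => hs.
have : 2 * K * \sum_(i < N) EP (fun w => (b i w)%:R) <= q.
  apply: (le_trans (ler_wpM2l _ hs)); first by rewrite mulr_ge0// ltW.
  have Kn0 : K != 0 by rewrite gt_eqF.
  have Nn0 : N%:R != 0 :> R by rewrite pnatr_eq0.
  rewrite le_eqVlt; apply/orP; left; apply/eqP; rewrite /s; clearbody N K q.
  by field; rewrite Nn0.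
by rewrite /q; lra.
Qed.

(* Exchanging coordinate [m] with its copy preserves the law and flips the sign
   of the second factor, so [f] may be replaced by half its increment. *)
Lemma swap_coordinate (f g : path nat E -> R) (a b : R) (m : nat) :
  bmf f -> bmf g -> 0 <= a -> 0 <= b ->
  EP (fun w => (f (mixed none w) - f (mixed (only m) w)) ^+ 2) <= a ^+ 2 ->
  EP (fun w => (g (mixed none w) - g (mixed (only m) w)) ^+ 2) <= b ^+ 2 ->
  `|EP (fun w => f (mixed none w) * (g (mixed (from m.+1) w) - g (mixed (from m) w)))|
     <= 2^-1 * (a * b).
Proof.
move=> bf bg a0 b0 fa gb.
have bs c (h : path nat E -> R) : bmf h -> bmf (fun y => h (select c y)).
  by move=> bh; exact: bmf_comp bh (measurable_select c).
pose G w := g (mixed (from m.+1) w) - g (mixed (from m) w).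
have bG : bmf G by apply: bmfB; exact: bmf_mixed.
pose F w := f (mixed none w) - f (mixed (only m) w).
have bF : bmf F by apply: bmfB; exact: bmf_mixed.
have -> : EP (fun w => f (mixed none w) * G w) = 2^-1 * EP (fun w => F w * G w).
  have E1 : EP (fun w => f (mixed none w) * G w) =
            EP (fun w => - (f (mixed (only m) w) * G w)).
    rewrite (@expectR_flip (only m) (fun y => f (select none y) *
       (g (select (from m.+1) y) - g (select (from m) y)))); last first.
      by apply: bmfM; [exact: bs|apply: bmfB; exact: bs].
    congr expectR; apply/funext => w; rewrite -mulrN /G opprB.
    congr (f _ * (g _ - g _)); apply/funext => k; rewrite /select /mixed /=.
    - by rewrite addbF.
    - by congr (e (_, _) w); case: (ltngtP m k).
    - by congr (e (_, _) w); case: (ltngtP m k).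
  have -> : EP (fun w => F w * G w) =
     EP (fun w => f (mixed none w) * G w) + EP (fun w => - (f (mixed (only m) w) * G w)).
    rewrite -expectRD; last 2 first.
    - by apply: bmfM => //; exact: bmf_mixed.
    - by apply: bmfN; apply: bmfM => //; exact: bmf_mixed.
    by congr expectR; apply/funext => w; rewrite /F mulrBl.
  by rewrite -E1; lra.
rewrite normrM ger0_norm ?invr_ge0// ler_pM2l ?invr_gt0//.
apply: cauchy_schwarz_expectR => //.
(* Flipping every coordinate from [m.+1] on turns [from m.+1] into [none] and [from m] into
   [only m]. *)
have -> : EP (fun w => G w ^+ 2) = EP (fun w => (g (mixed none w) - g (mixed (only m) w)) ^+ 2).
  rewrite (@expectR_flip (from m.+1) (fun y =>
     (g (select (from m.+1) y) - g (select (from m) y)) ^+ 2)); last first.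
    by apply: bmfX; apply: bmfB; exact: bs.
  congr expectR; apply/funext => w.
  congr ((g _ - g _) ^+ 2); apply/funext => k; rewrite /select /mixed /=.
  - by congr (e (_, _) w); case: (ltngtP m k).
  - by congr (e (_, _) w); case: (ltngtP m k).
exact: gb.
Qed.

(** The covariance is the mean of [f] times the change of [g] when the whole path is replaced by its
    copy. This change telescopes into single replacements below [M], bounded by [swap_coordinate],
    and a tail beyond [M], which [tail_L1] makes smaller than [r]. *)
Lemma covariance_bound (f g : path nat E -> R) (a b : nat -> R) :
  bmf f -> bmf g -> (forall m, 0 <= a m) -> (forall m, 0 <= b m) ->
  (forall m, EP (fun w => (f (mixed none w) - f (mixed (only m) w)) ^+ 2) <= a m ^+ 2) ->
  (forall m, EP (fun w => (g (mixed none w) - g (mixed (only m) w)) ^+ 2) <= b m ^+ 2) ->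
  forall r, 0 < r -> exists M0 : nat, forall M, (M0 <= M)%N ->
  `|EP (fun w => f (mixed none w) * g (mixed none w)) -
    EP (fun w => f (mixed none w)) * EP (fun w => g (mixed none w))|
    <= 2^-1 * \sum_(m < M) a m * b m + r.
Proof.
move=> bf bg a0 b0 fa gb r r0.
have [_ [K fK]] := bf.
have K1 : 0 < `|K| + 1 by rewrite ltr_wpDl.
have [M0 hM0] := tail_L1 bg (divr_gt0 r0 K1).
exists M0 => M /hM0 {}hM0.
(* The mean of [g] is evaluated on the copy, so that the product of means becomes the mean of a
   product; the mask [xpredT] is [from 0]. *)
rewrite -(mixed_law xpredT bg) -(iid_expectM ie bf bg).
pose X c := EP (fun w => f (mixed none w) * g (mixed c w)).
have bX c c' : bmf (fun w => f (mixed c w) * g (mixed c' w)).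
  by apply: bmfM; exact: bmf_mixed.
have bD c c' : bmf (fun w => f (mixed none w) * (g (mixed c w) - g (mixed c' w))).
  by apply: bmfM; [exact: bmf_mixed|apply: bmfB; exact: bmf_mixed].
have XB c c' : X c - X c' =
    EP (fun w => f (mixed none w) * (g (mixed c w) - g (mixed c' w))).
  by rewrite /X -expectRB//; congr expectR; apply/funext => w; rewrite mulrBr.
change (`|X none - X (from 0)| <= 2^-1 * \sum_(m < M) a m * b m + r).
have -> : X none - X (from 0%N) = (X none - X (from M)) +
    \sum_(m < M) (X (from m.+1) - X (from m)).
  by rewrite -(big_mkord xpredT (fun m => X (from m.+1) - X (from m)))
    telescope_sumr// addrA subrK.
apply: le_trans (ler_normD _ _) _; rewrite addrC; apply: lerD.
  rewrite mulr_sumr; apply: le_trans (ler_norm_sum _ _ _) _.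
  by apply: ler_sum => m _; rewrite XB; exact: swap_coordinate.
rewrite XB; apply: le_trans (ler_norm_expectR _) _; first exact: bD.
have bN : bmf (fun w => `|g (mixed none w) - g (mixed (from M) w)|).
  by apply: bmf_norm; apply: bmfB; exact: bmf_mixed.
apply: (@le_trans _ _ (EP (fun w => (`|K| + 1) * `|g (mixed none w) - g (mixed (from M) w)|))).
  apply: ler_expectR; [by apply: bmf_norm|exact: bmfZ|move=> w].
  rewrite normrM; apply: ler_wpM2r => //.
  by apply: le_trans (fK _) _; apply: le_trans (ler_norm _) _; rewrite lerDl.
by rewrite expectRZ// mulrC -ler_pdivlMr.
Qed.

End CovarianceBound.

(** * Variance and mean deviation of sums *)

Section VarianceOfSums.
Context {d : measure_display} {T : measurableType d} {R : realType}
  {P : probability T R} {dE : measure_display} {E : measurableType dE}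
  (e : bool * nat -> T -> E) (ie : iid (P := P) e).
Local Notation EP := (expectR P).
Local Notation none := (fun=> false).
Local Notation only m := (fun k => k == m).

Definition dependence_le (u : path nat E -> R) (a : nat -> R) : Prop :=
  forall m, 0 <= a m /\
    EP (fun w => (u (mixed e none w) - u (mixed e (only m) w)) ^+ 2) <= a m ^+ 2.

(** Product rule [u v - u' v' = u (v - v') + v' (u - u')] with factors bounded by one, then
    [(p + q)^2 <= 2 (p^2 + q^2)]. *)
Lemma dependence_leM (u v : path nat E -> R) (a b : nat -> R) :
  bmf u -> bmf v -> (forall y, `|u y| <= 1) -> (forall y, `|v y| <= 1) ->
  dependence_le u a -> dependence_le v b ->
  dependence_le (fun y => u y * v y) (fun m => 2 * (a m + b m)).
Proof.
move=> bu bv u1 v1 ua vb m.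
have [a0 {}ua] := ua m; have [b0 {}vb] := vb m; split; first by lra.
have bD (f : path nat E -> R) : bmf f ->
    bmf (fun w => (f (mixed e none w) - f (mixed e (only m) w)) ^+ 2).
  by move=> bf; apply: bmfX; apply: bmfB; exact: (bmf_mixed ie).
apply: (@le_trans _ _ (2 * (a m ^+ 2 + b m ^+ 2))); last by nra.
apply: (@le_trans _ _ (EP (fun w => 2 *
   ((u (mixed e none w) - u (mixed e (only m) w)) ^+ 2 +
    (v (mixed e none w) - v (mixed e (only m) w)) ^+ 2)))).
  apply: ler_expectR; [exact: (bD (fun y => u y * v y) (bmfM bu bv))
    |by apply: bmfZ; apply: bmfD; exact: bD|move=> w].
  set x := mixed e none w; set y := mixed e _ w.
  have sq (p q : R) : `|p| <= 1 -> (p * q) ^+ 2 <= q ^+ 2.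
    move=> p1; rewrite exprMn ler_piMl ?sqr_ge0//.
    by rewrite -real_normK ?num_real// expr_le1.
  have -> : u x * v x - u y * v y = u x * (v x - v y) + v y * (u x - u y) by ring.
  have := sq _ (v x - v y) (u1 x); have := sq _ (u x - u y) (v1 y).
  have := sqr_ge0 (u x * (v x - v y) - v y * (u x - u y)).
  set p := u x * (v x - v y); set q := v y * (u x - u y); nra.
rewrite expectRZ; last by apply: bmfD; exact: bD.
by rewrite expectRD; [lra|exact: bD|exact: bD].
Qed.

(* Schur's test bounds the quadratic form of the covariances by the row and
   column sums of the dependence coefficients. *)
Lemma variance_sum_le (n : nat) (u : nat -> path nat E -> R) (a : nat -> nat -> R)
    (A : R) :
  (forall i, bmf (u i)) -> (forall i, dependence_le (u i) (a i)) ->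
  (forall i M, \sum_(m < M) a i m <= A) -> (forall k m, \sum_(i < k) a i m <= A) ->
  EP (fun w => (\sum_(i < n) (u i (mixed e none w) -
                 EP (fun w => u i (mixed e none w)))) ^+ 2) <= n%:R * A ^+ 2.
Proof.
move=> bu ua rowA colA.
have a0 i m : 0 <= a i m by case: (ua i m).
have A0 : 0 <= A by have := rowA 0%N 0%N; rewrite big_ord0.
pose c i := EP (fun w => u i (mixed e none w)).
pose U i w := u i (mixed e none w).
have bU i : bmf (U i) by exact: (bmf_mixed ie).
have bUc i : bmf (fun w => U i w - c i) by apply: bmfB => //; exact: bmf_cst.
have -> : EP (fun w => (\sum_(i < n) (U i w - c i)) ^+ 2) =
    \sum_(i < n) \sum_(j < n) (EP (fun w => U i w * U j w) - c i * c j).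
  have -> : (fun w => (\sum_(i < n) (U i w - c i)) ^+ 2) =
      fun w => \sum_(i < n) \sum_(j < n) (U i w - c i) * (U j w - c j).
    by apply/funext => w; rewrite expr2 big_distrlr.
  rewrite expectR_sum; last by move=> i; apply: bmf_sum => j; exact: bmfM.
  apply: eq_bigr => i _; rewrite expectR_sum; last by move=> j; exact: bmfM.
  apply: eq_bigr => j _.
  have -> : (fun w => (U i w - c i) * (U j w - c j)) =
      fun w => (U i w * U j w - c i * U j w) - (c j * U i w - c i * c j).
    by apply/funext => w; ring.
  have b1 : bmf (fun w => U i w * U j w - c i * U j w).
    by apply: bmfB; [exact: bmfM|exact: bmfZ].
  have b2 : bmf (fun w => c j * U i w - c i * c j).
    by apply: bmfB; [exact: bmfZ|exact: bmf_cst].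
  rewrite (expectRB b1 b2) (expectRB (bmfM (bU i) (bU j)) (bmfZ _ (bU j))).
  rewrite (expectRB (bmfZ _ (bU i)) (bmf_cst _)) expectR_cst !expectRZ//.
  by rewrite -/(c i) -/(c j); ring.
apply/ler_addgt0Pr => r r0.
(* Each of the [n ^ 2] covariances carries an error [q]; together they stay below [r]. *)
pose q := r / (n%:R ^+ 2 + 1).
have q0 : 0 < q by rewrite divr_gt0// ltr_wpDl// sqr_ge0.
have cov i j : exists M0 : nat, forall M, (M0 <= M)%N ->
    EP (fun w => U i w * U j w) - c i * c j <= 2^-1 * \sum_(m < M) a i m * a j m + q.
  have [M0 hM0] := covariance_bound ie (bu i) (bu j) (a0 i) (a0 j)
    (fun m => (ua i m).2) (fun m => (ua j m).2) q0.
  by exists M0 => M /hM0; apply: le_trans; exact: ler_norm.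
have [M0 hM] : exists M, forall i j, (i < n)%N -> (j < n)%N ->
    EP (fun w => U i w * U j w) - c i * c j <= 2^-1 * \sum_(m < M) a i m * a j m + q.
  pose f i j := sval (cid (cov i j)).
  exists (\max_(i < n) \max_(j < n) f i j) => i j i_n j_n.
  have := svalP (cid (cov i j)); apply.
  apply: (@leq_trans (\max_(j < n) f i j)); last first.
    exact: (@leq_bigmax _ (fun i : 'I_n => \max_(j < n) f i j) (Ordinal i_n)).
  exact: (@leq_bigmax _ (fun j : 'I_n => f i j) (Ordinal j_n)).
apply: (@le_trans _ _ (\sum_(i < n) \sum_(j < n)
    (2^-1 * (\sum_(m < M0) a i m * a j m) + q))).
  by apply: ler_sum => i _; apply: ler_sum => j _; exact: hM.
have S1 (i : nat) : \sum_(j < n) \sum_(m < M0) a i m * a j m <= A ^+ 2.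
  rewrite exchange_big /=.
  apply: (@le_trans _ _ (\sum_(m < M0) a i m * A)).
    apply: ler_sum => m _; rewrite -mulr_sumr; apply: ler_wpM2l; [exact: a0|exact: colA].
  by rewrite -mulr_suml expr2; apply: ler_wpM2r => //; exact: rowA.
apply: (@le_trans _ _ (\sum_(i < n) (2^-1 * A ^+ 2 + n%:R * q))).
  apply: ler_sum => i _; rewrite big_split /= -mulr_sumr lerD//.
    by rewrite ler_wpM2l ?invr_ge0//; exact: S1.
  by rewrite sumr_const card_ord mulr_natl.
rewrite sumr_const card_ord -[leLHS]mulr_natl mulrDr lerD//.
  by rewrite ler_wpM2l// ler_piMl ?sqr_ge0//; lra.
by rewrite mulrA -expr2 /q mulrCA ler_piMr// ?(ltW r0)// ler_pdivrMr ?mul1r ?lerDl//.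
Qed.

Lemma mean_deviation_sum_le (n : nat) (u : nat -> path nat E -> R)
    (a : nat -> nat -> R) (A : R) :
  (forall i, bmf (u i)) -> (forall i, dependence_le (u i) (a i)) ->
  (forall i M, \sum_(m < M) a i m <= A) -> (forall k m, \sum_(i < k) a i m <= A) ->
  EP (fun w => `|\sum_(i < n) (u i (mixed e none w) -
                 EP (fun w => u i (mixed e none w)))|) <= Num.sqrt n%:R * A.
Proof.
move=> bu ua rowA colA.
have A0 : 0 <= A by have := rowA 0%N 0%N; rewrite big_ord0.
apply: expectR_norm_le.
- apply: bmf_sum => i; apply: bmfB; [exact: (bmf_mixed ie)|exact: bmf_cst].
- by rewrite mulr_ge0 ?sqrtr_ge0.
by rewrite exprMn sqr_sqrtr ?ler0n//; exact: variance_sum_le ua rowA colA.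
Qed.

End VarianceOfSums.

(** * The causal process: dependence coefficients and autocovariances *)

Section CausalProcess.
Context {d : measure_display} {T : measurableType d} {R : realType}
  {P : probability T R} {dE : measure_display} {E : measurableType dE}
  (eps : int -> T -> E) (eps0s : T -> E) (Y : (nat -> E) -> R).
Hypothesis ie : iid (P := P) (ext_family eps eps0s).
Hypothesis mY : seq_measurable Y.
Local Notation EP := (expectR P).
Local Notation X := (Xproc Y eps).
Local Notation none := (fun=> false).
Local Notation only m := (fun k => k == m).

Lemma measurable_functional : measurable_fun setT (Y : path nat E -> R).
Proof. by move=> _ B mB; rewrite setTI; exact: mY. Qed.

Lemma measurable_subpath {J : Type} (s : nat -> J) :
  measurable_fun setT (fun y : path J E => (fun k => y (s k)) : path nat E).
Proof.
by apply: (@measurable_path _ E _ (path J E)) => k; exact: measurable_coord.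
Qed.

Definition below (xi : R) (y : path nat E) : R := @ind01 R (Y y < xi).

Lemma bmf_below xi : bmf (below xi).
Proof.
apply: bmf_ind; apply: measurable_fun_ltr => //; exact: measurable_functional.
Qed.

Lemma measurable_Xproc t : measurable_fun setT (X t).
Proof.
apply: (measurableT_comp measurable_functional).
by apply: measurable_path => k; case: ie => /(_ (Some (t - k%:Z))).
Qed.

Lemma measurable_Xstar t : measurable_fun setT (Xstar Y eps eps0s t).
Proof.
apply: (measurableT_comp measurable_functional).
apply: measurable_path => k; case: ie => me _ _; case: eqP => _; first exact: (me None).
exact: (me (Some (t%:Z - k%:Z))).
Qed.

Lemma bmf_lt (Z : T -> R) xi : measurable_fun setT Z ->
  bmf (fun w => @ind01 R (Z w < xi)).
Proof. by move=> mZ; apply: bmf_ind; exact: measurable_fun_ltr. Qed.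

(* Coordinates are counted backwards from time [N]; as [X] is causal, the
   innovations after time [N] serve as the independent copy. *)
Definition reflected (N : nat) (j : bool * nat) : T -> E :=
  eps (if j.1 then N%:Z + 1 + j.2%:Z else N%:Z - j.2%:Z).

Lemma iid_reflected N : iid (P := P) (reflected N).
Proof.
have := @iid_comp _ _ _ P _ _ _ (bool * nat)%type _
  (fun j => Some (if j.1 then N%:Z + 1 + j.2%:Z else N%:Z - j.2%:Z)) _ ie.
apply => -[[] i] [[] j] /= [h]; try (by exfalso; lia); congr (_, _); lia.
Qed.

Lemma Xproc_reflected (N b : nat) (w : T) :
  Y (fun k => mixed (reflected N) none w (b + k)%N) = X (N%:Z - b%:Z) w.
Proof.
by congr Y; apply/funext => k; rewrite /mixed /reflected /=; congr (eps _ w); lia.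
Qed.

(** Coordinates run backwards in time, so dropping the first [b] of them moves the process [b] steps
    into the past. *)
Definition shifted (u : path nat E -> R) (b : nat) (y : path nat E) : R :=
  u (fun k => y (b + k)%N).

Lemma bmf_shifted u b : bmf u -> bmf (shifted u b).
Proof. by move=> bu; exact: bmf_comp bu (measurable_subpath _). Qed.

(** For [X] at time [N - b], coordinate [m] is the innovation [m - b] steps back, or a future one if
    [m < b]. Replacing it has the same joint law as replacing [eps 0] by [eps0s] in [X] at time
    [m - b]. *)
Lemma dependence_below (N b : nat) xi m :
  EP (fun w => (shifted (below xi) b (mixed (reflected N) none w) -
                shifted (below xi) b (mixed (reflected N) (only m) w)) ^+ 2) =
  if (b <= m)%N then L2nrm P (fun w => @ind01 R (X (m - b)%N%:Z w < xi) -
                     @ind01 R (Xstar Y eps eps0s (m - b) w < xi)) ^+ 2 else 0.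
Proof.
case: leqP => [bm|mb]; last first.
  rewrite -[RHS](@expectR_cst _ _ _ P); congr expectR; apply/funext => w.
  rewrite /shifted (_ : (fun k => mixed _ (only m) w _) =
    fun k => mixed (reflected N) none w (b + k)%N) ?subrr ?expr0n//.
  by apply/funext => k; rewrite /mixed gtn_eqF// ltn_addr.
set k0 := (m - b)%N.
pose h (y : path (option nat) E) := (below xi (fun k => y (Some k)) -
   below xi (fun k => y (if k == k0 then None else Some k))) ^+ 2.
have bh : bmf h.
  apply: bmfX; apply: bmfB.
    exact: (bmf_comp (bmf_below xi) (measurable_subpath _)).
  exact: (bmf_comp (bmf_below xi)
    (measurable_subpath (fun k => if k == k0 then None else Some k))).
(* [None] stands for the replacing innovation: under [s] it is the one at time [N + 1 + m], under
   [t] it is [eps0s]. *)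
pose s (o : option nat) : option int :=
  if o is Some k then Some (N%:Z - b%:Z - k%:Z) else Some (N%:Z + 1 + m%:Z).
pose t (o : option nat) : option int := if o is Some k then Some (k0%:Z - k%:Z) else None.
have injs : injective s.
  by move=> [i|] [j|] //= [?]; try (by exfalso; lia); congr Some; lia.
have injt : injective t by move=> [i|] [j|] //= [?]; congr Some; lia.
have := iid_reindex ie injs injt bh.
rewrite /h => hst.
transitivity (EP (fun w => h (fun j => ext_family eps eps0s (s j) w))).
  congr expectR; apply/funext => w; congr ((below xi _ - below xi _) ^+ 2).
    by apply/funext => k; rewrite /mixed /reflected /=; congr (eps _ w); lia.
  apply/funext => k; rewrite /mixed /reflected /=.
  have -> : ((b + k)%N == m) = (k == k0) by rewrite /k0; lia.
  case: eqP => [->|_] /=; congr (eps _ w); rewrite /k0; lia.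
rewrite [LHS]hst /L2nrm sqr_sqrtr; last first.
  by apply: expectR_ge0 => w; rewrite sqr_ge0.
congr expectR; apply/funext => w; rewrite real_normK ?num_real//.
congr ((below xi _ - below xi _) ^+ 2).
by apply/funext => k; case: eqP.
Qed.

(** Bounds the set under the supremum in (C), so that this [sup] is a genuine upper bound. *)
Lemma L2nrm_below_le1 xi t :
  L2nrm P (fun w => @ind01 R (X t%:Z w < xi) -
                    @ind01 R (Xstar Y eps eps0s t w < xi)) <= 1.
Proof.
rewrite -[leRHS]sqrtr1; apply: ler_wsqrtr.
rewrite -[leRHS](@expectR_cst _ _ _ P); apply: ler_expectR.
- apply/bmfX/bmf_norm/bmfB; apply: bmf_lt; [exact: measurable_Xproc|exact: measurable_Xstar].
- exact: bmf_cst.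
- move=> w; rewrite expr_le1// /ind01.
  by do 2 case: (_ < _); rewrite ?subrr ?subr0 ?sub0r ?normrN ?normr0 ?normr1.
Qed.

Lemma stationary_pair (u v : path nat E -> R) (s t c : int) : bmf u -> bmf v ->
  EP (fun w => u (fun k => eps (s - k%:Z) w) * v (fun k => eps (t - k%:Z) w)) =
  EP (fun w => u (fun k => eps (s + c - k%:Z) w) * v (fun k => eps (t + c - k%:Z) w)).
Proof.
move=> bu bv.
pose h (y : path int E) := u (fun k => y (s - k%:Z)) * v (fun k => y (t - k%:Z)).
have bh : bmf h.
  by apply: bmfM; [exact: (bmf_comp bu (measurable_subpath (fun k => s - k%:Z)))
    |exact: (bmf_comp bv (measurable_subpath (fun k => t - k%:Z)))].
have i1 : injective (@Some int) by move=> i j [].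
have i2 : injective (fun i : int => Some (i + c)) by move=> i j []/addIr.
rewrite [LHS](iid_reindex ie i1 i2 bh); congr expectR; apply/funext => w.
by congr (u _ * v _); apply/funext => k /=; congr (eps _ w); lia.
Qed.

Lemma stationary_below (xi : R) t :
  EP (fun w => @ind01 R (X t w < xi)) = EP (fun w => @ind01 R (X 0 w < xi)).
Proof.
transitivity (EP (fun w => below xi (fun k => eps (0 + t - k%:Z) w) * 1)).
  by congr expectR; apply/funext => w; rewrite mulr1 add0r.
rewrite -(stationary_pair 0 0 t (bmf_below xi) (bmf_cst 1)).
by congr expectR; apply/funext => w; rewrite mulr1.
Qed.

Variables (xi0 delta : R).

Definition dep_coef (t : nat) : R :=
  sup [set L2nrm P (fun w => @ind01 R (X t%:Z w < xi) -
                             @ind01 R (Xstar Y eps eps0s t w < xi))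
      | xi in [set xi | `|xi0 - xi| <= delta]].

Lemma L2nrm_le_dep_coef t xi : `|xi0 - xi| <= delta ->
  L2nrm P (fun w => @ind01 R (X t%:Z w < xi) -
                    @ind01 R (Xstar Y eps eps0s t w < xi)) <= dep_coef t.
Proof.
move=> xid; apply: ub_le_sup; last by exists xi.
by exists 1 => _ [x _ <-]; exact: L2nrm_below_le1.
Qed.

Lemma dep_coef_ge0 t : 0 <= delta -> 0 <= dep_coef t.
Proof.
move=> d0; apply: le_trans (L2nrm_le_dep_coef t (_ : `|xi0 - xi0| <= delta)).
  exact: sqrtr_ge0.
by rewrite subrr normr0.
Qed.

Lemma dep_coef_partial_sums : 0 <= delta ->
  (\sum_(0 <= t <oo) (dep_coef t)%:E < +oo)%E ->
  exists C : R, forall M, \sum_(m < M) dep_coef m <= C.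
Proof.
move=> d0 S.
have D0 n : (0 <= (dep_coef n)%:E)%E by rewrite lee_fin dep_coef_ge0.
exists (fine (\sum_(0 <= t <oo) (dep_coef t)%:E)%E) => M.
rewrite -lee_fin fineK; last first.
  by rewrite ge0_fin_numE//; apply: nneseries_ge0 => n _ _.
rewrite -sumEFin -(big_mkord xpredT (fun t => (dep_coef t)%:E)).
by apply: nneseries_lim_ge => n _ _.
Qed.

Hypothesis delta0 : 0 <= delta.
Variable C : R.
Hypothesis sumC : forall M, \sum_(m < M) dep_coef m <= C.

(** A triangular Toeplitz matrix: its partial row and column sums are dominated by partial sums of
    [dep_coef], hence by [C], as Schur's test requires. *)
Definition lagged (b m : nat) : R := if (b <= m)%N then dep_coef (m - b) else 0.

Lemma lagged_ge0 b m : 0 <= lagged b m.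
Proof. by rewrite /lagged; case: ifP => // _; exact: dep_coef_ge0. Qed.

Lemma lagged_row b M : \sum_(m < M) lagged b m <= C.
Proof.
elim: b M => [|b ih] M.
  rewrite (eq_bigr (fun m : 'I_M => dep_coef m)) => [|m _].
    exact: sumC.
  by rewrite /lagged leq0n subn0.
case: M => [|M]; first by rewrite big_ord0; have := sumC 0; rewrite big_ord0.
by rewrite big_ord_recl /= /lagged /= add0r; exact: ih.
Qed.

Lemma lagged_col k m : \sum_(b < k) lagged b m <= C.
Proof.
apply: le_trans (sumC m.+1).
elim: m k => [|m ih] [|k]; rewrite ?big_ord0 ?sumr_ge0//; try by move=> i _; exact: dep_coef_ge0.
  rewrite big_ord_recl big1 => [|i _]; last by rewrite /lagged.
  by rewrite big_ord_recr big_ord0 /= add0r addr0 /lagged leqnn subnn.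
rewrite big_ord_recl /= big_ord_recr /= addrC.
apply: lerD; first by rewrite /lagged leq0n subn0.
by apply: le_trans (ih k); apply: ler_sum => i _; rewrite /lagged.
Qed.

Lemma dependence_le_below N b xi : `|xi0 - xi| <= delta ->
  dependence_le (P := P) (reflected N) (shifted (below xi) b) (lagged b).
Proof.
move=> xid m; split; first exact: lagged_ge0.
rewrite dependence_below /lagged; case: leqP => _; last by rewrite expr0n.
rewrite lerXn2r ?nnegrE ?sqrtr_ge0 ?dep_coef_ge0//.
exact: L2nrm_le_dep_coef.
Qed.

Lemma sum_reflect (n j : nat) (F : nat -> R) :
  \sum_(j.+1 <= t < n.+1) F t = \sum_(b < n - j) F (n - b)%N.
Proof.
rewrite big_nat_rev /= -{1}[j.+1]add0n big_addn subSS big_mkord.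
by apply: eq_bigr => i _; congr F; lia.
Qed.

Lemma empirical_cdf_deviation (n : nat) (xi : R) : `|xi0 - xi| <= delta ->
  EP (fun w => `|\sum_(1 <= t < n.+1) (@ind01 R (X t%:Z w < xi) -
                   EP (fun w => @ind01 R (X 0 w < xi)))|) <= Num.sqrt n%:R * C.
Proof.
move=> xid.
have := mean_deviation_sum_le (iid_reflected n) n
  (fun b => bmf_shifted b (bmf_below xi)) (fun b => dependence_le_below n b xid)
  lagged_row lagged_col.
apply: le_trans; rewrite le_eqVlt; apply/orP; left; apply/eqP.
congr expectR; apply/funext => w; congr `|_|.
rewrite sum_reflect subn0; apply: eq_bigr => b _.
have E1 w' : shifted (below xi) b (mixed (reflected n) none w') =
    @ind01 R (X (n - b)%N%:Z w' < xi).
  rewrite /shifted /below Xproc_reflected; congr (@ind01 R (X _ _ < _)).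
  by have := ltn_ord b; lia.
rewrite E1 -(stationary_below xi (n - b)%N%:Z); congr (_ - _).
by congr expectR; apply/funext => w'; rewrite E1.
Qed.

Variable tau : R.
Hypothesis tau01 : 0 < tau < 1.
Local Notation V := (Vt X tau xi0).

Definition score (y : path nat E) : R := tau - below xi0 y.

Lemma bmf_score : bmf score.
Proof. by apply: bmfB; [exact: bmf_cst|exact: bmf_below]. Qed.

Lemma score_le1 y : `|score y| <= 1.
Proof.
have /andP[t0 t1] := tau01.
by rewrite ler_norml /score /below /ind01; case: (_ < _) => /=; apply/andP; split; lra.
Qed.

Lemma dependence_le_score N b :
  dependence_le (P := P) (reflected N) (shifted score b) (lagged b).
Proof.
move=> m; have xx : `|xi0 - xi0| <= delta by rewrite subrr normr0.
have [h1 h2] := dependence_le_below N b xx m; split => //.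
apply: le_trans h2; rewrite le_eqVlt; apply/orP; left; apply/eqP.
by congr expectR; apply/funext => w; rewrite /shifted /score; ring.
Qed.

Lemma score_reflected N b w :
  shifted score b (mixed (reflected N) none w) = V (N%:Z - b%:Z) w.
Proof. by rewrite /shifted /score /below Xproc_reflected. Qed.

Lemma rtau_shift (s t : int) : EP (fun w => V s w * V t w) = rtau P X tau xi0 (t - s).
Proof.
rewrite /rtau -[LHS]/(EP (fun w => score (fun k => eps (s - k%:Z) w) *
                                   score (fun k => eps (t - k%:Z) w))).
by rewrite (stationary_pair s t (- s) bmf_score bmf_score) subrr.
Qed.

Lemma rtau_abs (j : int) : rtau P X tau xi0 j = rtau P X tau xi0 `|j|%N%:Z.
Proof.
case: (intP j) => [|n|n] //; rewrite abszN /=.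
rewrite -[in RHS](subr0 n.+1%:Z) -rtau_shift -(sub0r n.+1%:Z) -rtau_shift.
by congr expectR; apply/funext => w; rewrite mulrC.
Qed.

(** By the product rule the coefficients of a lagged product are
    [2 * (lagged b m + lagged (b + j) m)]; both summands have row and column sums at most [C],
    whence [4 * C] for every lag [j]. *)
Lemma autocovariance_deviation (n j : nat) :
  EP (fun w => `|\sum_(j.+1 <= t < n.+1) (V t%:Z w * V (t%:Z - j%:Z) w -
                   rtau P X tau xi0 j%:Z)|) <= Num.sqrt n%:R * (4 * C).
Proof.
have C0 : 0 <= C by have := sumC 0; rewrite big_ord0.
have s1 b y : `|shifted score b y| <= 1 by exact: score_le1.
have bs b := bmf_shifted b bmf_score.
have := mean_deviation_sum_le (iid_reflected n) (n - j)
  (u := fun b y => shifted score b y * shifted score (b + j) y)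
  (a := fun b m => 2 * (lagged b m + lagged (b + j) m)) (A := 4 * C)
  (fun b => bmfM (bs b) (bs (b + j)%N))
  (fun b => dependence_leM (iid_reflected n) (bs b) (bs (b + j)%N) (s1 b) (s1 (b + j)%N)
     (dependence_le_score n b) (dependence_le_score n (b + j)%N)).
have h1 b M : \sum_(m < M) 2 * (lagged b m + lagged (b + j) m) <= 4 * C.
  rewrite -mulr_sumr big_split /=.
  have := lagged_row b M; have := lagged_row (b + j) M; lra.
have h2 k m : \sum_(b < k) 2 * (lagged b m + lagged (b + j) m) <= 4 * C.
  rewrite -mulr_sumr big_split /=.
  (* A column sum over shifted indices is part of a longer column sum. *)
  have h3 : \sum_(b < k) lagged (b + j) m <= \sum_(b < j + k) lagged b m.
    rewrite big_split_ord /= -[leLHS]add0r lerD//.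
      by apply: sumr_ge0 => i _; exact: lagged_ge0.
    by apply: ler_sum => i _; rewrite addnC.
  have := lagged_col k m; have := lagged_col (j + k) m; lra.
move=> /(_ h1 h2) H.
apply: (@le_trans _ _ (Num.sqrt (n - j)%N%:R * (4 * C))); last first.
  by apply: ler_wpM2r; [lra|rewrite ler_wsqrtr// ler_nat leq_subr].
apply: le_trans H; rewrite le_eqVlt; apply/orP; left; apply/eqP.
congr expectR; apply/funext => w; congr `|_|.
rewrite sum_reflect; apply: eq_bigr => b _.
have E1 w' : shifted score b (mixed (reflected n) none w') *
    shifted score (b + j) (mixed (reflected n) none w') =
    V (n - b)%N%:Z w' * V ((n - b)%N%:Z - j%:Z) w'.
  by rewrite !score_reflected; congr (V _ _ * V _ _); have := ltn_ord b; lia.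
rewrite E1; congr (_ - _).
transitivity (EP (fun w => V (n - b)%N%:Z w * V ((n - b)%N%:Z - j%:Z) w)).
  by rewrite rtau_shift rtau_abs [RHS]rtau_abs; congr rtau; lia.
by congr expectR; apply/funext => w'; rewrite E1.
Qed.

Hypothesis mean0 : EP (V 0) = 0.

(** As [V] is centred, [rtau] is a covariance, bounded by half of [\sum_m lagged 0 m * lagged j m].
    Summing over [j] first gives a column sum, then a row sum remains: at most [C * C]. *)
Lemma rtau_partial_sums (J : nat) :
  \sum_(j < J) `|rtau P X tau xi0 j%:Z| <= C ^+ 2.
Proof.
have C0 : 0 <= C by have := sumC 0; rewrite big_ord0.
apply/ler_addgt0Pr => r r0.
pose q := r / (J%:R + 1).
have J1 : 0 < J%:R + 1 :> R by rewrite ltr_wpDl.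
have q0 : 0 < q by rewrite divr_gt0.
have cov j : exists M0 : nat, forall M, (M0 <= M)%N ->
    `|rtau P X tau xi0 j%:Z| <= 2^-1 * \sum_(m < M) lagged 0 m * lagged j m + q.
  (* Seen backwards from time [j], the score at time [j] has shift [0] and the score at time [0] has
     shift [j]. *)
  have [M0 hM0] := covariance_bound (iid_reflected j)
    (bmf_shifted 0 bmf_score) (bmf_shifted j bmf_score)
    (lagged_ge0 0) (lagged_ge0 j) (fun m => (dependence_le_score j 0 m).2)
    (fun m => (dependence_le_score j j m).2) q0.
  exists M0 => M /hM0; apply: le_trans.
  rewrite le_eqVlt; apply/orP; left; apply/eqP; congr `|_|.
  have -> : EP (fun w => shifted score j (mixed (reflected j) none w)) = 0.
    by rewrite -mean0; congr expectR; apply/funext => w; rewrite score_reflected subrr.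
  rewrite mulr0 subr0.
  transitivity (EP (fun w => V (j%:Z - 0%:Z) w * V (j%:Z - j%:Z) w)).
    by rewrite rtau_shift rtau_abs [RHS]rtau_abs; congr rtau; lia.
  by congr expectR; apply/funext => w; rewrite !score_reflected.
have [M hM] : exists M, forall j, (j < J)%N ->
    `|rtau P X tau xi0 j%:Z| <= 2^-1 * \sum_(m < M) lagged 0 m * lagged j m + q.
  pose f j := sval (cid (cov j)).
  exists (\max_(j < J) f j) => j jJ; have := svalP (cid (cov j)); apply.
  exact: (@leq_bigmax _ (fun j : 'I_J => f j) (Ordinal jJ)).
apply: (@le_trans _ _ (\sum_(j < J) (2^-1 * (\sum_(m < M) lagged 0 m * lagged j m) + q))).
  by apply: ler_sum => j _; exact: hM.
rewrite big_split /= -mulr_sumr sumr_const card_ord lerD//; last first.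
  by rewrite -mulr_natl /q mulrCA ler_piMr ?(ltW r0)// ler_pdivrMr// mul1r lerDl.
rewrite exchange_big /=.
have h : \sum_(m < M) \sum_(j < J) lagged 0 m * lagged j m <= C ^+ 2.
  apply: (@le_trans _ _ (\sum_(m < M) lagged 0 m * C)).
    by apply: ler_sum => m _; rewrite -mulr_sumr; apply: ler_wpM2l;
      [exact: lagged_ge0|exact: lagged_col].
  by rewrite -mulr_suml expr2; apply: ler_wpM2r => //; exact: lagged_row.
have := sqr_ge0 C; lra.
Qed.

End CausalProcess.

(** * The quantile of the marginal law *)

Lemma Rintegral_itv_ge (R : realType) (f : R -> R) (x y c : R) : x <= y ->
  (@lebesgue_measure R).-integrable `]x, y] (EFin \o f) ->
  (forall z, x < z <= y -> c <= f z) ->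
  c * (y - x) <= Rintegral (@lebesgue_measure R) `]x, y] f.
Proof.
move=> xy intf cf.
have mu : lebesgue_measure `]x, y]%classic = (y - x)%:E.
  rewrite lebesgue_measure_itv /= lte_fin; case: ltP => // yx.
  by congr (_%:E); lra.
have -> : c * (y - x) = Rintegral lebesgue_measure `]x, y] (fun=> c).
  by rewrite Rintegral_cst//= mu.
apply: le_Rintegral => //.
apply: measurable_bounded_integrable => //; first by rewrite /= mu ltry.
exists `|c|; split; first exact: num_real.
by move=> z Mz t _ /=; exact: ltW.
Qed.

Section Quantile.
Context {d : measure_display} {T : measurableType d} {R : realType}
  {P : probability T R} (Z : T -> R) (mZ : measurable_fun setT Z).
Local Notation F := (cdfX P Z).

Let mle x : measurable [set w | Z w <= x].
Proof.
rewrite (_ : [set _ | _] = Z @^-1` `]-oo, x]).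
  by rewrite -[X in measurable X]setTI; exact: mZ.
by apply/seteqP; split => w /=; rewrite in_itv.
Qed.

Let mlt x : measurable [set w | Z w < x].
Proof.
rewrite (_ : [set _ | _] = Z @^-1` `]-oo, x[).
  by rewrite -[X in measurable X]setTI; exact: mZ.
by apply/seteqP; split => w /=; rewrite in_itv.
Qed.

Let fineP_le (A B : set T) : measurable A -> measurable B -> A `<=` B ->
  fine (P A) <= fine (P B).
Proof.
move=> mA mB AB; rewrite fine_le ?fin_num_measure//.
by apply: le_measure; rewrite ?inE.
Qed.

Lemma cdfX_nondecreasing x y : x <= y -> F x <= F y.
Proof. by move=> xy; apply: fineP_le => // w /= /le_trans; apply. Qed.

Let cdfXE : EFin \o F = cdf (P := P) (mfun_Sub (mem_set mZ)).
Proof.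
by apply/funext => x /=; rewrite fineK ?fin_num_measure.
Qed.

Lemma cdfX_exceeds (tau : R) : tau < 1 -> exists x, tau <= F x.
Proof.
move=> t1; have := @cvg_cdfy1 _ _ _ P (mfun_Sub (mem_set mZ)).
rewrite -cdfXE => /fine_cvgP[_] /cvgrPdist_lt /(_ (1 - tau)).
rewrite subr_gt0 => /(_ t1) [M [_ hM]]; exists (M + 1).
have /hM /= : M < M + 1 by rewrite ltrDl.
by rewrite ltr_norml => /andP[_ ?]; lra.
Qed.

Lemma cdfX_below (tau : R) : 0 < tau -> exists x, F x < tau.
Proof.
move=> t0; have := @cvg_cdfNy0 _ _ _ P (mfun_Sub (mem_set mZ)).
rewrite -cdfXE => /fine_cvgP[_] /cvgrPdist_lt /(_ tau t0) [M [_ hM]]; exists (M - 1).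
have /hM /= : M - 1 < M by rewrite ltrBlDr ltrDl.
by rewrite ltr_norml => /andP[? _]; lra.
Qed.

Variables (tau : R).
Hypothesis tau01 : 0 < tau < 1.
Local Notation xi0 := (quantile0 F tau).

(** The limits of [F] at both infinities make the [inf] in [quantile0] a true infimum rather than a
    default value. *)
Let quantile_has_inf : has_inf [set x | tau <= F x].
Proof.
have /andP[t0 t1] := tau01; split; first exact: cdfX_exceeds.
have [y Fy] := cdfX_below t0; exists y => x /= Fx.
by rewrite leNgt; apply/negP => /ltW/cdfX_nondecreasing; lra.
Qed.

Variables eta L : R.
Hypothesis eta0 : 0 < eta.
Hypothesis lipF : forall x y : R, `|x - xi0| < eta -> `|y - xi0| < eta ->
  `|F x - F y| <= L * `|x - y|.

Let xi0_eta : `|xi0 - xi0| < eta. Proof. by rewrite subrr normr0. Qed.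

Lemma lipschitz_ge0 : 0 <= L.
Proof.
have e0 := eta0.
have h : `|xi0 + eta / 2 - xi0| < eta.
  by rewrite addrAC subrr add0r ger0_norm; lra.
have := lipF h xi0_eta; rewrite (_ : xi0 + eta / 2 - xi0 = eta / 2); last by ring.
rewrite (@ger0_norm _ (eta / 2)); last lra.
by have := normr_ge0 (F (xi0 + eta / 2) - F xi0); nra.
Qed.

Let small_step (r : R) : 0 < r -> exists h, [/\ 0 < h, h < eta & L * h < r].
Proof.
move=> r0; have L0 := lipschitz_ge0; have e0 := eta0.
exists (Num.min (eta / 2) (r / (L + 1) / 2)).
have h1 : 0 < r / (L + 1) by rewrite divr_gt0//; lra.
split.
- by rewrite lt_min; apply/andP; split; lra.
- by rewrite gt_min; apply/orP; left; lra.
apply: (@le_lt_trans _ _ (L * (r / (L + 1) / 2))).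
  by rewrite ler_wpM2l// ge_min lexx orbT.
have : (L + 1) * (r / (L + 1)) = r by field; lra.
by set q := r / (L + 1); nra.
Qed.

(** [F] is below [tau] left of the infimum and at least [tau] right of it; Lipschitz continuity
    closes the gap. *)
Lemma cdfX_quantile : F xi0 = tau.
Proof.
apply/eqP; rewrite eq_le; apply/andP; split; apply/ler_addgt0Pr => r r0.
  have [h [h0 heta Lh]] := small_step r0.
  have hF : F (xi0 - h) < tau.
    rewrite ltNge; apply/negP => Fh.
    have := ge_inf quantile_has_inf.2 Fh; rewrite /quantile0; lra.
  have : `|xi0 - h - xi0| < eta by rewrite addrAC subrr add0r normrN gtr0_norm.
  move=> /(lipF xi0_eta); rewrite (_ : xi0 - (xi0 - h) = h); last by ring.
  rewrite (gtr0_norm h0) => hh; by have := ler_norm (F xi0 - F (xi0 - h)); lra.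
have [h [h0 heta Lh]] := small_step r0.
have [x tx xh] := inf_adherent h0 quantile_has_inf.
have Fxh : tau <= F (xi0 + h) by apply: le_trans tx _; apply: cdfX_nondecreasing; exact: ltW.
have : `|xi0 + h - xi0| < eta by rewrite addrAC subrr add0r gtr0_norm.
move=> /lipF /(_ xi0_eta); rewrite (_ : xi0 + h - xi0 = h); last by ring.
rewrite (gtr0_norm h0) => hh.

by have := ler_norm (F (xi0 + h) - F xi0); lra.
Qed.

(** The scores use a strict inequality and [F] a weak one; Lipschitz continuity excludes atoms near
    [xi0]. *)
Lemma expectR_lt x : `|x - xi0| < eta ->
  expectR P (fun w => @ind01 R (Z w < x)) = F x.
Proof.
move=> xeta; rewrite (expectR_ind (mlt x)); last by [].
apply/eqP; rewrite eq_le; apply/andP; split.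
  by apply: fineP_le => // w /= /ltW.
apply/ler_addgt0Pr => r r0.
have [h0 [h00 _ Lh]] := small_step r0.
pose h := Num.min h0 ((eta - `|x - xi0|) / 2).
have hpos : 0 < h by rewrite lt_min h00/=; lra.
have hx : `|x - h - xi0| < eta.
  have : h <= (eta - `|x - xi0|) / 2 by rewrite ge_min lexx orbT.
  move=> ?; rewrite addrAC; apply: le_lt_trans (ler_normB _ _) _.
  by rewrite (gtr0_norm hpos); lra.
have hh0 : h <= h0 by rewrite ge_min lexx.
have := lipF xeta hx; rewrite (_ : x - (x - h) = h); last by ring.
rewrite (gtr0_norm hpos) => hh.

have F1 : F (x - h) <= fine (P [set w | Z w < x]).
  by apply: fineP_le => // w /= /le_lt_trans; apply; lra.
have := ler_norm (F x - F (x - h)); have := lipschitz_ge0.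
have : L * h <= L * h0 by rewrite ler_wpM2l// lipschitz_ge0.
lra.
Qed.

Variables (f : R -> R) (eta' : R).
Hypothesis eta'0 : 0 < eta'.
Hypothesis intf : (@lebesgue_measure R).-integrable
  [set y | xi0 - eta' <= y <= xi0 + eta'] (fun y => (f y)%:E).
Hypothesis densityF : forall x : R, xi0 - eta' <= x <= xi0 + eta' ->
  F x - F (xi0 - eta') =
  Rintegral (@lebesgue_measure R) [set y | xi0 - eta' <= y <= x] f.
Hypothesis contf : {for xi0, continuous f}.
Hypothesis f0 : 0 < f xi0.

(** Continuity keeps the density above half its value at [xi0] on a small interval to the left, and
    [c] is this half. *)
Lemma density_lower_bound : exists c h0 : R, [/\ 0 < c, 0 < h0 &
  forall h, 0 < h -> h <= h0 -> c * h <= F xi0 - F (xi0 - h)].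
Proof.
have e0 := eta'0; have f2 : 0 < f xi0 / 2 by rewrite divr_gt0.
have := contf; move=> /cvgrPdist_lt /(_ _ f2) [r /= r0 hr].
exists (f xi0 / 2), (Num.min eta' (r / 2)); split => //.
  by rewrite lt_min eta'0 divr_gt0.
move=> h h0; rewrite le_min => /andP[he hr2].
have fh y : xi0 - h < y <= xi0 -> f xi0 / 2 <= f y.
  move=> /andP[y1 y2]; have : `|xi0 - y| < r by rewrite ger0_norm; lra.
  by move=> /hr; rewrite ltr_norml => /andP[_ ?]; lra.
have h1 : xi0 - eta' <= xi0 <= xi0 + eta' by apply/andP; split; lra.
have h2 : xi0 - eta' <= xi0 - h <= xi0 + eta' by apply/andP; split; lra.
have -> : F xi0 - F (xi0 - h) = (F xi0 - F (xi0 - eta')) - (F (xi0 - h) - F (xi0 - eta')) by ring.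
rewrite (densityF h1) (densityF h2).
have sE a b : [set y : R | a <= y <= b] = `[a, b]%classic.
  by apply/seteqP; split => y /=; rewrite in_itv.
have U : `[xi0 - eta', xi0]%classic = `[xi0 - eta', xi0 - h] `|` `]xi0 - h, xi0].
  apply/seteqP; split => y /=; rewrite !in_itv /=.
    move=> /andP[y1 y2]; case: (leP y (xi0 - h)) => hy; [left|right].
      by rewrite y1.
    by rewrite y2.
  by move=> [/andP[y1 y2]|/andP[y1 y2]]; apply/andP; split; lra.
rewrite !sE U.
have int1 : lebesgue_measure.-integrable (`[xi0 - eta', xi0 - h] `|` `]xi0 - h, xi0]) (EFin \o f).
  apply: integrableS intf; rewrite -?U ?sE //.
  by move=> y /=; rewrite !in_itv /= => /andP[y1 y2]; apply/andP; split; lra.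
rewrite Rintegral_setU//; last first.
  rewrite disj_set2E; apply/eqP; rewrite -subset0 => y /= [].
  by rewrite !in_itv /= => /andP[_ y1] /andP[y2 _]; lra.
rewrite addrC addKr.
have -> : f xi0 / 2 * h = f xi0 / 2 * (xi0 - (xi0 - h)) by congr (_ * _); ring.
apply: Rintegral_itv_ge => //; first by lra.
by apply: integrableS int1 => //; rewrite -U; exact: measurable_itv.
Qed.

End Quantile.

(** * Sample quantiles and their effect on the autocovariances *)

Section SampleQuantile.
Context {T : Type} {R : realType} (X : int -> T -> R) (tau : R) (tau01 : 0 < tau < 1).

Definition count_below (n : nat) (w : T) (x : R) : R :=
  \sum_(1 <= t < n.+1) @ind01 R (X t%:Z w < x).

Lemma ind01_lt_mono (z x y : R) : x <= y -> @ind01 R (z < x) <= @ind01 R (z < y).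
Proof.
by move=> xy; rewrite /ind01; case: ltP => //= zx; rewrite (lt_le_trans zx xy).
Qed.

Lemma count_below_mono n w x y : x <= y -> count_below n w x <= count_below n w y.
Proof. by move=> xy; apply: ler_sum => t _; exact: ind01_lt_mono. Qed.

Lemma sum_tau_sub_ind n w x : \sum_(1 <= t < n.+1) (tau - @ind01 R (X t%:Z w < x)) =
  n%:R * tau - count_below n w x.
Proof.
by rewrite sumrB sumr_const_nat subSS subn0 mulr_natl.
Qed.

(** The subgradient inequality at [y] for the check loss, convex in the location. *)
Lemma rho_check_step (z x y : R) : x <= y ->
  (y - x) * (tau - @ind01 R (z < y)) <= rho_check tau (z - x) - rho_check tau (z - y).
Proof.
move=> xy; rewrite /rho_check !subr_lt0 /ind01.
have /andP[t0 t1] := tau01.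
by case: (ltP z x); case: (ltP z y) => /= ? ?; nra.
Qed.

Lemma sample_quantile_ge n w x y : is_sample_quantile X tau n w x ->
  count_below n w y < n%:R * tau -> y <= x.
Proof.
move=> qx cy; rewrite leNgt; apply/negP => xy.
have := qx y; apply/negP; rewrite -ltNge -subr_gt0 -sumrB.
apply: (@lt_le_trans _ _ (\sum_(1 <= t < n.+1) (y - x) * (tau - @ind01 R (X t%:Z w < y)))).
  by rewrite -mulr_sumr sum_tau_sub_ind mulr_gt0// subr_gt0.
by apply: ler_sum => t _; apply: rho_check_step; exact: ltW.
Qed.

(** No observation lies strictly between [y] and [x], so the check loss is affine on [[y, x]]. *)
Lemma count_below_attained n w x : exists2 y, y < x &
  forall t, (t < n.+1)%N -> (X t%:Z w < x) = (X t%:Z w <= y).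
Proof.
elim: n => [|n [y yx hy]].
  case: (ltP (X 0 w) x) => h.
    by exists (X 0 w) => // -[|//] _; rewrite lexx h.
  exists (x - 1) => [|[|//] _]; first by lra.
  by rewrite ltNge h /=; apply/esym/negbTE; rewrite -ltNge; lra.
exists (Num.max y (if X n.+1 w < x then X n.+1 w else y)).
  by rewrite gt_max yx; case: ifP.
move=> t; rewrite ltnS leq_eqVlt => /predU1P[->|tn].
  rewrite le_max; case: ifP => [h|/negbT h]; first by rewrite lexx orbT.
  rewrite orbb; apply/esym/negbTE; rewrite -ltNge; apply: lt_le_trans yx _.
  by rewrite leNgt.
rewrite hy// le_max; case: ifP => h; last by rewrite orbb.
by apply/idP/idP => [->//|/orP[//|h2]]; rewrite -hy//; exact: le_lt_trans h2 h.
Qed.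

(** The left derivative of the loss at a minimizer is nonpositive; on the affine stretch it is an
    exact difference quotient. *)
Lemma sample_quantile_count n w x : is_sample_quantile X tau n w x ->
  count_below n w x <= n%:R * tau.
Proof.
move=> qx; have [y yx hy] := count_below_attained n w x.
have := qx y; rewrite -subr_ge0 -sumrB.
rewrite (_ : \sum_(1 <= t < n.+1) _ =
   (x - y) * \sum_(1 <= t < n.+1) (tau - @ind01 R (X t%:Z w < x))).
  by rewrite pmulr_rge0 ?subr_gt0// sum_tau_sub_ind subr_ge0.
rewrite mulr_sumr; apply: eq_big_nat => t /andP[_ tn].
rewrite /rho_check !subr_lt0 /ind01 (hy _ tn); case: (leP (X t%:Z w) y) => h /=.
  case: (ltP (X t%:Z w) y) => h' /=; first by ring.
  have -> : X t%:Z w = y by apply/le_anti; rewrite h h'.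
  by ring.
by rewrite (ltNge _ y) (ltW h) /=; ring.
Qed.

Lemma count_below_sample_quantile n w x0 x y : is_sample_quantile X tau n w x ->
  y <= x0 -> count_below n w y < n%:R * tau ->
  `|count_below n w x - count_below n w x0| <=
  `|count_below n w x0 - n%:R * tau| + `|count_below n w y - n%:R * tau|.
Proof.
move=> qx yx0 cy; have cx := sample_quantile_count qx; have yx := sample_quantile_ge qx cy.
have n1 := normr_ge0 (count_below n w y - n%:R * tau).
have n2 := ler_norm (count_below n w x0 - n%:R * tau).
have n3 := ler_norm (- (count_below n w x0 - n%:R * tau)).
have n4 := ler_norm (- (count_below n w y - n%:R * tau)).
rewrite !normrN in n3 n4.
case: (leP x0 x) => [/(count_below_mono n w) h|/ltW/(count_below_mono n w) h].
  by rewrite ger0_norm ?subr_ge0//; lra.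
rewrite ler0_norm ?subr_le0//.
by have := count_below_mono n w yx; lra.
Qed.

(** Indicators are monotone in the threshold, so all differences have one sign and nothing
    cancels. *)
Lemma sum_norm_ind n w x y :
  \sum_(1 <= t < n.+1) `|@ind01 R (X t%:Z w < x) - @ind01 R (X t%:Z w < y)| =
  `|count_below n w x - count_below n w y|.
Proof.
wlog xy : x y / x <= y.
  move=> H; case: (leP x y) => [/H//|/ltW/H E1].
  by rewrite distrC -E1; apply: eq_bigr => t _; exact: distrC.
rewrite distrC ger0_norm ?subr_ge0 ?count_below_mono// -sumrB.
by apply: eq_bigr => t _; rewrite distrC ger0_norm// subr_ge0 ind01_lt_mono.
Qed.

Lemma Vt_le1 x t w : `|Vt X tau x t w| <= 1.
Proof.
have /andP[t0 t1] := tau01.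
by rewrite ler_norml /Vt /ind01; case: (_ < _) => /=; apply/andP; split; lra.
Qed.

(** Either factor of a product may change, whence the [2]; extending each lagged sum to the whole
    sample makes the bound uniform in [j]. *)
Lemma rhat_quantile_error n w x y j :
  `|rhat X tau x n w j - rhat X tau y n w j| <=
  n%:R^-1 * (2 * `|count_below n w x - count_below n w y|).
Proof.
rewrite /rhat -mulrBr normrM ger0_norm ?invr_ge0// ler_wpM2l ?invr_ge0//.
rewrite -sumrB -sum_norm_ind.
set G := fun t : nat => `|@ind01 R (X t%:Z w < x) - @ind01 R (X t%:Z w < y)|.
apply: (@le_trans _ _ (\sum_((absz j).+1 <= t < n.+1) (G t + G (t - absz j)%N))).
  apply: le_trans (ler_norm_sum _ _ _) _; apply: ler_sum_nat => t /andP[jt tn].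
  have -> : t%:Z - (absz j)%:Z = (t - absz j)%N%:Z by lia.
  set a := Vt X tau x t%:Z w; set b := Vt X tau x (t - absz j)%N%:Z w.
  set a' := Vt X tau y t%:Z w; set b' := Vt X tau y (t - absz j)%N%:Z w.
  have -> : a * b - a' * b' = (a - a') * b + a' * (b - b') by ring.
  apply: le_trans (ler_normD _ _) _; rewrite !normrM; apply: lerD.
    apply: (@le_trans _ _ `|a - a'|); first by rewrite ler_piMr// Vt_le1.
    have -> : a - a' = - (@ind01 R (X t%:Z w < x) - @ind01 R (X t%:Z w < y)).
      by rewrite /a /a' /Vt; ring.
    by rewrite normrN.
  apply: (@le_trans _ _ `|b - b'|); first by rewrite ler_piMl// Vt_le1.
  have -> : b - b' = - (@ind01 R (X (t - absz j)%N%:Z w < x) -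
      @ind01 R (X (t - absz j)%N%:Z w < y)) by rewrite /b /b' /Vt; ring.
  by rewrite normrN.
have G0 t : 0 <= G t by exact: normr_ge0.
rewrite big_split /= [leRHS]mulr_natl [leRHS]mulr2n lerD//.
  case: (leqP (absz j) n) => jn; last by rewrite big_geq ?sumr_ge0// ltnS ltnW.
  by rewrite (@big_cat_nat _ _ _ (absz j).+1 1 n.+1)//= lerDr sumr_ge0.
rewrite -{1}[(absz j).+1]addn1 addnC big_addn.
case: (leqP (absz j) n) => jn; last first.
  by rewrite big_geq ?sumr_ge0//; lia.
under eq_bigr do rewrite addnK.
by rewrite (@big_cat_nat _ _ _ (n.+1 - absz j) 1 n.+1)//= ?lerDl ?sumr_ge0//; lia.
Qed.

End SampleQuantile.

(** * Tails of nonnegative series *)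

Section Summability.
Context {R : realType} (s : nat -> R) (s0 : forall j, 0 <= s j) (C : R)
  (sC : forall J, \sum_(j < J) s j <= C).

Lemma summable_tail (r : R) : 0 < r ->
  exists J, forall n, (J <= n)%N -> \sum_(J <= j < n) s j <= r.
Proof.
move=> r0; pose S := [set \sum_(j < J) s j | J in [set: nat]].
have hS : has_sup S.
  split; first by exists (\sum_(j < 0) s j), 0%N.
  by exists C => _ [J _ <-]; exact: sC.
have [_ [J _ <-] hJ] := sup_adherent r0 hS.
exists J => n Jn.
have : \sum_(j < n) s j <= sup S by apply: (ub_le_sup hS.2); exists n.
rewrite -!(big_mkord xpredT s) in hJ *.
by rewrite (@big_cat_nat _ _ _ J)//=; lra.
Qed.

(** Beyond a fixed [J] the tail of [s] absorbs the bound [A]; the finitely many terms before [J]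
    vanish one by one. *)
Lemma tannery (c : nat -> nat -> R) (A : R) :
  (forall j, c^~ j @ \oo --> 0) -> (forall n j, (j < n)%N -> `|c n j| <= A) ->
  forall r, 0 < r ->
  exists n0, forall n, (n0 <= n)%N -> \sum_(j < n) `|c n j| * s j <= r.
Proof.
move=> c0 cA r r0.
have A1 : 0 < `|A| + 1 by rewrite ltr_wpDl.
have [J hJ] := summable_tail (divr_gt0 (divr_gt0 r0 (ltr0n R 2)) A1).
have fin (q : R) : 0 < q -> exists n0, forall n, (n0 <= n)%N ->
    \sum_(j < J) `|c n j| * s j <= q.
  elim: J {hJ} q => [|J ih] q q0.
    by exists 0%N => n _; rewrite big_ord0 ltW.
  have q2 : 0 < q / 2 by rewrite divr_gt0.
  have [n1 h1] := ih _ q2.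
  have sJ : 0 < s J + 1 by rewrite ltr_wpDl.
  have /cvgrPdist_lt /(_ _ (divr_gt0 q2 sJ)) [n2 _ h2] := c0 J.
  exists (maxn n1 n2) => n; rewrite geq_max => /andP[/h1 {}h1 /h2 /=].
  rewrite sub0r normrN => h; rewrite big_ord_recr /=.
  have : `|c n J| * s J <= q / 2.
    apply: (@le_trans _ _ (`|c n J| * (s J + 1))); first by rewrite ler_wpM2l// lerDl.
    by rewrite -ler_pdivlMr// ltW.
  lra.
have r2 : 0 < r / 2 by rewrite divr_gt0.
have [n1 h1] := fin _ r2.
exists (maxn n1 J) => n; rewrite geq_max => /andP[/h1 {}h1 Jn].
rewrite -(big_mkord xpredT (fun j => `|c n j| * s j)) (@big_cat_nat _ _ _ J)//=.
rewrite big_mkord.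
have : \sum_(J <= j < n) `|c n j| * s j <= r / 2.
  apply: (@le_trans _ _ ((`|A| + 1) * \sum_(J <= j < n) s j)).
    rewrite mulr_sumr; apply: ler_sum_nat => j /andP[_ jn].
    rewrite ler_wpM2r// (le_trans (cA _ _ jn))//.
    by rewrite (le_trans (ler_norm _))// lerDl.
  by rewrite mulrC -ler_pdivlMr//; exact: hJ.
lra.
Qed.

End Summability.

(** * Trigonometric sums over lags and the bias *)

Section LagSums.
Context {R : realType}.

(** The common shape of the partial sums in [gtau] and of [ghat]: for sample size [n.+1] the lags
    run from [- n] to [n]. *)
Definition trig_sum (c : int -> R) (N : nat) (lam : R) : R :=
  \sum_(k < N.*2.+1) c (k%:Z - N%:Z) * cos ((k%:Z - N%:Z)%:~R * lam).

Lemma sum_lags_le (h : nat -> R) (n : nat) : (forall j, 0 <= h j) ->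
  \sum_(k < n.*2.-1) h (absz (k%:Z - (n.-1)%:Z)) <= 2 * \sum_(j < n) h j.
Proof.
move=> h0; case: n => [|n]; first by rewrite !big_ord0 mulr0.
rewrite (_ : n.+1.*2.-1 = (n + n.+1)%N) /=; last by lia.
rewrite big_split_ord /= mulr_natl mulr2n lerD//.
  rewrite [leLHS](_ : _ = \sum_(j < n) h j.+1).
    by rewrite [leRHS]big_ord_recl lerDr.
  rewrite (reindex_inj rev_ord_inj); apply: eq_bigr => i _ /=.
  by congr h; have := ltn_ord i; lia.
by apply: ler_sum => i _; rewrite (_ : absz _ = i)//; lia.
Qed.

Lemma trig_sumS (c : int -> R) N lam : trig_sum c N.+1 lam =
  trig_sum c N lam + (c N.+1%:Z * cos (N.+1%:~R * lam) +
                      c (- N.+1%:Z) * cos ((- N.+1%:Z)%:~R * lam)).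
Proof.
rewrite /trig_sum doubleS big_ord_recl big_ord_recr /= [LHS]addrC -[LHS]addrA.
congr (_ + (_ + _)).
- by apply: eq_bigr => i _; rewrite (_ : (bump 0 i)%:Z - N.+1%:Z = i%:Z - N%:Z)// /bump; lia.
- by rewrite (_ : (bump 0 N.*2.+1)%:Z - N.+1%:Z = N.+1%:Z)// /bump; lia.
- by rewrite sub0r.
Qed.

Lemma normr_cos_le1 (x : R) : `|cos x| <= 1.
Proof. by rewrite ler_norml cos_geN1 cos_le1. Qed.

Lemma trig_sum_norm (c : int -> R) N lam :
  `|trig_sum c N lam| <= \sum_(k < N.*2.+1) `|c (k%:Z - N%:Z)|.
Proof.
apply: le_trans (ler_norm_sum _ _ _) _; apply: ler_sum => k _.
by rewrite normrM ler_piMr// normr_cos_le1.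
Qed.

Lemma continuous_trig_sum (c : int -> R) N : continuous (trig_sum c N).
Proof.
have cterm (z : int) : continuous (fun lam : R => c z * cos (z%:~R * lam)).
  move=> x; apply: cvgM; first exact: cvg_cst.
  apply: (@continuous_comp _ _ _ (fun lam : R => z%:~R * lam) cos); last exact: continuous_cos.
  by apply: cvgM; [exact: cvg_cst|exact: cvg_id].
elim: N => [|N ih].
  rewrite (_ : trig_sum c 0 = fun lam => c 0 * cos (0%:~R * lam)); first exact: cterm.
  by apply/funext => lam; rewrite /trig_sum big_ord_recl big_ord0 addr0 /= subrr.
rewrite (_ : trig_sum c N.+1 = fun lam => trig_sum c N lam +
  (c N.+1%:Z * cos (N.+1%:~R * lam) + c (- N.+1%:Z) * cos ((- N.+1%:Z)%:~R * lam))).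
  by move=> x; apply: cvgD; [exact: ih|apply: cvgD; exact: cterm].
by apply/funext => lam; exact: trig_sumS.
Qed.

Variables (r : int -> R) (C : R).
Hypothesis r_even : forall j, r j = r (absz j)%:Z.
Hypothesis r_sum : forall J, \sum_(j < J) `|r j%:Z| <= C.

Let s j := `|r j%:Z|.
Let s0 j : 0 <= s j. Proof. exact: normr_ge0. Qed.

Lemma trig_sum_dist N M lam : (N <= M)%N ->
  `|trig_sum r M lam - trig_sum r N lam| <= 2 * \sum_(N.+1 <= j < M.+1) `|r j%:Z|.
Proof.
elim: M => [|M ih]; first by rewrite leqn0 => /eqP ->; rewrite subrr normr0 big_geq// mulr0.
rewrite leq_eqVlt => /predU1P[->|NM]; first by rewrite subrr normr0 big_geq// mulr0.
rewrite trig_sumS big_nat_recr//= mulrDr addrAC.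
apply: le_trans (ler_normD _ _) _; apply: lerD; first exact: ih.
apply: le_trans (ler_normD _ _) _; rewrite mulr_natl mulr2n; apply: lerD.
  by rewrite normrM ler_piMr// normr_cos_le1.
by rewrite normrM r_even abszN /= ler_piMr// normr_cos_le1.
Qed.

Let twopi : 0 < (2 * pi : R)^-1 <= 1.
Proof.
have p2 := @pi_ge2 R.
have pi2 : 1 <= 2 * pi :> R by lra.
have pi0 : 0 < 2 * pi :> R by lra.
by rewrite invr_gt0 pi0 invf_le1.
Qed.

(** The tail bound does not involve [lam], hence one [N0] for all frequencies. The Cauchy property
    also ensures that the [limn] in [gtau] is an actual limit. *)
Lemma gtau_approx (q : R) : 0 < q -> exists N0, forall N lam, (N0 <= N)%N ->
  `|(2 * pi)^-1 * trig_sum r N lam - gtau r lam| <= q.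
Proof.
move=> q0; have [J hJ] := summable_tail (s := s) r_sum (divr_gt0 q0 (ltr0n R 2)).
have close N M lam : (J <= N)%N -> (N <= M)%N ->
    `|trig_sum r M lam - trig_sum r N lam| <= q.
  move=> JN NM; apply: (le_trans (trig_sum_dist _ NM)).
  have h1 : \sum_(J <= j < M.+1) s j <= q / 2.
    by apply: hJ; rewrite (leq_trans JN)// (leq_trans NM).
  have h2 : \sum_(N.+1 <= j < M.+1) s j <= \sum_(J <= j < M.+1) s j.
    rewrite (@big_cat_nat _ _ _ N.+1 J)//=; last by rewrite ltnW.
    by rewrite lerDr sumr_ge0.
  by rewrite -/(s _) in h1 h2 *; lra.
have cvgT lam : cvgn (trig_sum r ^~ lam).
  apply/cauchy_cvgP/cauchy_exP => e e0.
  have [J' hJ'] := summable_tail (s := s) r_sum (divr_gt0 e0 (ltr0n R 4)).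
  exists (trig_sum r J' lam), J' => // M /= J'M; rewrite /ball /= distrC.
  apply: (le_lt_trans (trig_sum_dist _ J'M)).
  have h1 : \sum_(J' <= j < M.+1) s j <= e / 4 by apply: hJ'; exact: leqW.
  have h2 : \sum_(J'.+1 <= j < M.+1) s j <= \sum_(J' <= j < M.+1) s j.
    by rewrite [leRHS]big_ltn ?ltnS// lerDr.
  by rewrite -/(s _) in h1 h2 *; lra.
exists J => N lam JN.
have -> : gtau r lam = (2 * pi)^-1 * limn (trig_sum r ^~ lam) by [].
rewrite -mulrBr normrM gtr0_norm; last by case/andP: twopi.
apply: (@le_trans _ _ `|trig_sum r N lam - limn (trig_sum r ^~ lam)|).
  by rewrite ler_piMl//; case/andP: twopi.
have near_le : \forall M \near \oo, `|trig_sum r M lam - trig_sum r N lam| <= q.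
  by exists N => // M /= NM; exact: close.
rewrite ler_norml; apply/andP; split.
  rewrite lerBrDr addrC -lerBrDr opprK; apply: limr_le; first exact: cvgT.
  by apply: filterS near_le => M; rewrite ler_norml => /andP[]; lra.
rewrite lerBlDr addrC -lerBlDr; apply: limr_ge; first exact: cvgT.
by apply: filterS near_le => M; rewrite ler_norml => /andP[]; lra.
Qed.

(** A uniform limit of trigonometric sums; it serves the measurability of the supremum. *)
Lemma continuous_gtau : continuous (gtau r).
Proof.
move=> x; apply/cvgrPdist_le => q q0.
have q3 : 0 < q / 3 by rewrite divr_gt0.
have [N hN] := gtau_approx q3.
have /cvgrPdist_le /(_ _ q3) := @continuous_trig_sum r N x.
apply: filterS => y hy.
have hx := hN N x (leqnn N); have {}hN := hN N y (leqnn N).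
set a := trig_sum r N x in hx hy *; set b := trig_sum r N y in hN hy *.
have hab : `|(2 * pi)^-1 * a - (2 * pi)^-1 * b| <= q / 3.
  rewrite -mulrBr normrM gtr0_norm; last by case/andP: twopi.
  by apply: le_trans hy; rewrite ler_piMl//; case/andP: twopi.
rewrite !ler_norml in hx hN hab *.
by move: hx hN hab => /andP[? ?] /andP[? ?] /andP[? ?]; apply/andP; split; lra.
Qed.

Lemma gtau_bounded : exists M, forall lam, `|gtau r lam| <= M.
Proof.
have [N hN] := gtau_approx ltr01.
exists (1 + \sum_(k < N.*2.+1) `|r (k%:Z - N%:Z)|) => lam.
have := hN N lam (leqnn N).
have h2 : `|(2 * pi)^-1 * trig_sum r N lam| <= \sum_(k < N.*2.+1) `|r (k%:Z - N%:Z)|.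
  apply: le_trans (trig_sum_norm r N lam).
  rewrite normrM gtr0_norm; last by case/andP: twopi.
  by rewrite ler_piMl//; case/andP: twopi.
rewrite !ler_norml in h2 *; move: h2 => /andP[? ?] /andP[? ?].
by apply/andP; split; lra.
Qed.

(** Relative to [r j] the expected estimator carries the weight error [w(j / B) (1 - j / n) - 1],
    bounded by [A + 1] and vanishing for each fixed [j]. Folding negative lags costs a factor two,
    so [q / 4] is asked of the one-sided sum. *)
Lemma lag_window_bias (wk : R -> R) (A : R) (B : nat -> R) :
  (forall x, `|wk x| <= A) -> continuous wk -> (forall x, wk x = wk (- x)) -> wk 0 = 1 ->
  B @ \oo --> +oo ->
  forall q, 0 < q -> exists n0, forall n, (n0 <= n)%N -> forall lam,
  `|(2 * pi)^-1 * trig_sum (fun j => wk (j%:~R / B n.+1) *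
       ((1 - (absz j)%:R / n.+1%:R) * r j)) n lam - gtau r lam| <= q.
Proof.
move=> wA cw we w0 Boo q q0.
have q2 : 0 < q / 2 by rewrite divr_gt0.
have q4 : 0 < q / 4 by rewrite divr_gt0.
have BV : (fun n => (B n)^-1) @ \oo --> 0.
  apply/(gtr0_cvgV0 (f := B)) => //.
  by move/cvgryPgt : Boo => /(_ 0).
have nV : (fun n : nat => n%:R^-1 : R) @ \oo --> 0.
  apply/gtr0_cvgV0; last exact: cvgr_idn.
  by exists 1%N => // n /=; rewrite ltr0n.
pose c (n j : nat) := wk (j%:R / B n) * (1 - j%:R / n%:R) - 1.
have c0 j : c^~ j @ \oo --> 0.
  have h1 : (fun n => j%:R / B n) @ \oo --> 0.
    by rewrite -[X in _ --> X](mulr0 j%:R); apply: cvgM; [exact: cvg_cst|].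
  have h2 : (fun n : nat => 1 - j%:R / n%:R : R) @ \oo --> (1 : R).
    rewrite -[X in _ --> X](subr0 1); apply: cvgB; first exact: cvg_cst.
    by rewrite -[X in _ --> X](mulr0 j%:R); apply: cvgM; [exact: cvg_cst|].
  rewrite -[X in _ --> X](subrr 1); apply: cvgB; last exact: cvg_cst.
  have h3 : (fun n => wk (j%:R / B n)) @ \oo --> (1 : R).
    rewrite -[X in _ --> X]w0.
    by apply: (@continuous_cvg _ _ _ _ _ (fun n => j%:R / B n) wk 0) => //; exact: cw.
  by rewrite -[X in _ --> X](mulr1 1); exact: cvgM.
have cA n j : (j < n)%N -> `|c n j| <= A + 1.
  move=> jn; apply: le_trans (ler_normB _ _) _; rewrite normr1 lerD2r normrM.
  apply: le_trans (wA (j%:R / B n)); rewrite ler_piMr//.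
  have n0 : 0 < n%:R :> R by rewrite ltr0n (leq_trans _ jn).
  have h : j%:R / n%:R <= 1 :> R by rewrite ler_pdivrMr// mul1r ler_nat ltnW.
  have h' : 0 <= j%:R / n%:R :> R by rewrite divr_ge0.
  by rewrite ler_norml; apply/andP; split; lra.
have [n1 h1] := tannery (s := s) s0 r_sum c0 cA q4.
have [n2 h2] := gtau_approx q2.
exists (maxn n1 n2) => n; rewrite geq_max => /andP[n1n n2n] lam.
have {}h2 := h2 n lam n2n; have {}h1 := h1 n.+1 (leqW n1n).
set U := trig_sum _ n lam.
have h3 : `|U - trig_sum r n lam| <= q / 2.
  rewrite /U /trig_sum -sumrB; apply: le_trans (ler_norm_sum _ _ _) _.
  apply: (@le_trans _ _ (\sum_(k < n.+1.*2.-1)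
      (`|c n.+1 (absz (k%:Z - n%:Z))| * s (absz (k%:Z - n%:Z))))).
    apply: ler_sum => k _; set j := k%:Z - n%:Z.
    rewrite -mulrBl normrM; apply: le_trans (ler_piMr (normr_ge0 _) (normr_cos_le1 _)) _.
    rewrite (_ : _ - r j = (wk (j%:~R / B n.+1) * (1 - (absz j)%:R / n.+1%:R) - 1) * r j);
      last by ring.
    rewrite normrM /s -r_even ler_wpM2r//.
    rewrite /c; case: (intP j) => [|m|m] //=.
    by rewrite we -mulNr -mulrNz opprK.
  have hs j : 0 <= `|c n.+1 j| * s j by rewrite mulr_ge0.
  by apply: le_trans (sum_lags_le n.+1 hs) _; lra.
rewrite (_ : _ - _ = (2 * pi)^-1 * (U - trig_sum r n lam) +
    ((2 * pi)^-1 * trig_sum r n lam - gtau r lam)); last by ring.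
apply: le_trans (ler_normD _ _) _.
have : `|(2 * pi)^-1 * (U - trig_sum r n lam)| <= q / 2.
  rewrite normrM gtr0_norm; last by case/andP: twopi.
  by apply: le_trans h3; rewrite ler_piMl//; case/andP: twopi.
lra.
Qed.

End LagSums.

(** * The kernel sum *)

Section KernelSum.
Context {R : realType} (wk : R -> R) (A : R) (wA : forall x, `|wk x| <= A).
Local Notation wbar := (wbar_w wk).

Let wbar_ub x y : x <= y -> `|wk y| <= wbar x.
Proof.
move=> xy; apply: ub_le_sup; last by exists y.
by exists A => _ [z _ <-]; exact: wA.
Qed.

Let wbar_ge0 x : 0 <= wbar x.
Proof. exact: le_trans (normr_ge0 _) (wbar_ub (lexx x)). Qed.

Let wbar_noninc x y : x <= y -> wbar y <= wbar x.
Proof.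
move=> xy; apply: sup_le_ub; first by exists `|wk y|, y => //=.
by move=> _ [z /= yz <-]; apply: wbar_ub; exact: le_trans yz.
Qed.

Hypothesis wbar_int : (@lebesgue_measure R).-integrable [set x | 0 <= x]
  (fun x => (wbar x)%:E).

(** A lower Riemann sum of mesh [b^-1]: [wbar] is nonincreasing, so its value at a right endpoint is
    at most its mean over the cell. *)
Lemma wbar_riemann_sum (b : R) (n : nat) : 0 < b ->
  \sum_(j < n) wbar (j.+1%:R / b) <=
  b * Rintegral (@lebesgue_measure R) [set x | 0 <= x] wbar.
Proof.
move=> b0.
have half : [set x : R | 0 <= x] = `[0, +oo[%classic.
  by apply/seteqP; split => x /=; rewrite in_itv /= andbT.
have mhalf : measurable [set x : R | 0 <= x] by rewrite half; exact: measurable_itv.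
have intS (D : set R) : measurable D -> D `<=` [set x | 0 <= x] ->
    (@lebesgue_measure R).-integrable D (EFin \o wbar).
  by move=> mD DS; exact: integrableS wbar_int.
have step m : b^-1 * \sum_(j < m) wbar (j.+1%:R / b) <=
    Rintegral (@lebesgue_measure R) `]0, m%:R / b] wbar.
  elim: m => [|m ih].
    by rewrite big_ord0 mulr0; apply: Rintegral_ge0 => x _; exact: wbar_ge0.
  have m0 : 0 <= m%:R / b by rewrite divr_ge0// ltW.
  have mb : m.+1%:R / b = m%:R / b + b^-1 by rewrite -natr1 mulrDl mul1r.
  have bV : 0 < b^-1 by rewrite invr_gt0.
  rewrite big_ord_recr /= mulrDr.
  have U : `]0, m.+1%:R / b]%classic = `]0, m%:R / b] `|` `]m%:R / b, m.+1%:R / b].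
    apply/seteqP; split => x /=; rewrite !in_itv /=.
      move=> /andP[x1 x2]; case: (leP x (m%:R / b)) => hx; [left|right].
        by rewrite x1.
      by rewrite x2.
    by move=> [/andP[x1 x2]|/andP[x1 x2]]; apply/andP; split; lra.
  rewrite U Rintegral_setU//; last 2 first.
  - rewrite -U; apply: intS => // x /=; rewrite in_itv /= => /andP[x1 _]; exact: ltW.
  - rewrite disj_set2E; apply/eqP; rewrite -subset0 => x /= [].
    by rewrite !in_itv /= => /andP[_ x1] /andP[x2 _]; lra.
  apply: lerD => //.
  rewrite (_ : b^-1 * _ = wbar (m.+1%:R / b) * (m.+1%:R / b - m%:R / b)); last first.
    by rewrite mb; ring.
  apply: Rintegral_itv_ge.
  - by rewrite mb lerDl ltW.
  - apply: intS => // x /=; rewrite in_itv /= => /andP[x1 _]; lra.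
  - by move=> x /andP[_ x1]; exact: wbar_noninc.
rewrite -ler_pdivrMl//; apply: (le_trans (step n)).
rewrite -lee_fin /Rintegral !fineK.
- apply: ge0_subset_integral => //.
  + by apply/measurable_int: wbar_int.
  + by move=> x _; rewrite lee_fin.
  + by move=> x /=; rewrite in_itv /= => /andP[x1 _]; exact: ltW.
- exact: integrable_fin_num.
- apply: integrable_fin_num => //; apply: intS => // x /=.
  by rewrite in_itv /= => /andP[x1 _]; exact: ltW.
Qed.

(** Lag zero costs at most [A], the positive lags at most [b * I], and reflection doubles. With
    [1 <= b] the sum is at most [2 * (A + I) * b]; the added [1] ensures [1 <= K]. *)
Lemma kernel_sum_le : (forall x, wk x = wk (- x)) ->
  exists K, 1 <= K /\ forall b n, 1 <= b ->
  \sum_(k < n.*2.-1) `|wk ((k%:Z - (n.-1)%:Z)%:~R / b)| <= K * b.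
Proof.
move=> we; set I := Rintegral (@lebesgue_measure R) [set x | 0 <= x] wbar.
have I0 : 0 <= I by apply: Rintegral_ge0 => x _; exact: wbar_ge0.
have A0 : 0 <= A by apply: le_trans (wA 0).
exists (1 + 2 * (A + I)); split; first by lra.
move=> b n b1; have b0 : 0 < b by lra.
rewrite (eq_bigr (fun k : 'I_(n.*2.-1) =>
    `|wk ((absz (k%:Z - (n.-1)%:Z))%:R / b)|)); last first.
  move=> k _; case: (intP (_ - _)) => [|m|m] //=.
  by rewrite we -mulNr -mulrNz opprK.
apply: le_trans (sum_lags_le (h := fun j => `|wk (j%:R / b)|) _ _) _ => //.
case: n => [|n]; first by rewrite big_ord0; nra.
rewrite big_ord_recl /=.
have h1 : \sum_(i < n) `|wk ((bump 0 i)%:R / b)| <= b * I.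
  by apply: le_trans (wbar_riemann_sum n b0); apply: ler_sum => i _; exact: wbar_ub.
have h2 := wA (0%:R / b).
nra.
Qed.

End KernelSum.

(** By continuity the uncountable supremum exceeds [eta] exactly when some rational frequency
    does. *)
Lemma measurable_sup_gt {d} {T : measurableType d} {R : realType}
    (h : T -> R -> R) (a b eta : R) : a < b ->
  (forall lam, measurable_fun setT (h^~ lam)) -> (forall w, continuous (h w)) ->
  (forall w, exists M, forall lam, `|h w lam| <= M) ->
  measurable [set w | eta < sup [set `|h w lam| | lam in [set lam | a < lam <= b]]].
Proof.
move=> ab mh ch bh.
have -> : [set w | eta < sup [set `|h w lam| | lam in [set lam | a < lam <= b]]] =
    \bigcup_(q in [set q : rat | a < ratr q <= b]) [set w | eta < `|h w (ratr q)|].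
  apply/seteqP; split => w /=.
    move=> /sup_gt [|_ [lam /andP[al lb] <-] hl].
      by exists `|h w b|, b => //=; rewrite ab lexx.
    have : \forall x \near lam, eta < `|h w x|.
      have cn : {for lam, continuous (fun x => `|h w x|)}.
        by apply: continuous_comp; [exact: ch|exact: norm_continuous].
      exact: (cvgr_gt _ cn _ hl).
    move=> [r /= r0 hr].
    (* The rational is taken left of [lam], so that it stays in the interval even at its right
       end. *)
    have : Num.max a (lam - r) < lam by rewrite gt_max al /= ltrBlDr ltrDl.
    move=> /rat_in_itvoo[q]; rewrite in_itv /= gt_max => /andP[/andP[aq rq] ql].
    exists q => /=; first by rewrite aq (le_trans (ltW ql)).
    apply: (hr (ratr q)); rewrite /= ger0_norm ?subr_ge0 ?(ltW ql)//.
    by rewrite ltrBlDr addrC -ltrBlDr.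
  move=> [q /= qab hq]; apply: (lt_le_trans hq); apply: ub_le_sup; last by exists (ratr q).
  by have [M hM] := bh w; exists M => _ [lam _ <-].
rewrite bigcup_mkcond; apply: bigcupT_measurable_rat => q; case: ifP => // _.
rewrite (_ : [set w | _] = (fun w => `|h w (ratr q)|) @^-1` `]eta, +oo[).
  rewrite -[X in measurable X]setTI.
  by apply: (measurableT_comp (@normr_measurable _ _) (mh (ratr q))).
by apply/seteqP; split => w /=; rewrite in_itv /= andbT.
Qed.

(** * Error of the lag-window estimator at finite sample size *)

Section SpectralEstimator.
Context {d : measure_display} {T : measurableType d} {R : realType}
  {P : probability T R} {dE : measure_display} {E : measurableType dE}
  (eps : int -> T -> E) (eps0s : T -> E) (Y : (nat -> E) -> R).
Hypothesis ie : iid (P := P) (ext_family eps eps0s).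
Hypothesis mY : seq_measurable Y.
Local Notation EP := (expectR P).
Local Notation X := (Xproc Y eps).
Variables (tau : R) (wk : R -> R) (xi0 : R).
Hypothesis tau01 : 0 < tau < 1.
Local Notation r := (rtau P X tau xi0).

Lemma bmf_Vt_random (q : T -> R) t : measurable_fun setT q ->
  bmf (fun w => Vt X tau (q w) t w).
Proof.
move=> mq; apply: bmfB; first exact: bmf_cst.
by apply: bmf_ind; apply: measurable_fun_ltr => //; exact: (measurable_Xproc ie mY).
Qed.

Lemma bmf_rhat (q : T -> R) n j : measurable_fun setT q ->
  bmf (fun w => rhat X tau (q w) n w j).
Proof.
move=> mq; apply: bmfZ; apply: bmf_sum => t.
by apply: bmfM; exact: bmf_Vt_random.
Qed.

Lemma bmf_ghat (q : T -> R) b n lam : measurable_fun setT q ->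
  bmf (fun w => ghat X tau wk b (q w) n w lam).
Proof.
move=> mq; apply: bmfZ; apply: bmf_sum => k.
apply: bmfM; last exact: bmf_cst.
by apply: bmfZ; exact: bmf_rhat.
Qed.

Lemma ghatE b q n w lam : ghat X tau wk b q n.+1 w lam =
  (2 * pi)^-1 * trig_sum (fun j => wk (j%:~R / b) * rhat X tau q n.+1 w j) n lam.
Proof. by []. Qed.

(** The centring [(1 - |j| / n) r j] is the exact mean of [rhat] at the true quantile: [n - |j|]
    terms divided by [n]. *)
Definition window_noise (b : R) (n : nat) (w : T) : R :=
  \sum_(k < n.*2.-1) (let j := k%:Z - (n.-1)%:Z in
    `|wk (j%:~R / b)| * `|rhat X tau xi0 n w j - (1 - (absz j)%:R / n%:R) * r j|).

Lemma bmf_window_noise b n : bmf (window_noise b n).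
Proof.
apply: bmf_sum => k; apply: bmfZ; apply: bmf_norm; apply: bmfB; last exact: bmf_cst.
exact: (@bmf_rhat (fun=> xi0)).
Qed.

(** The autocovariance error splits into a quantile part, uniform in the lag and so multiplied by
    the kernel sum, and the noise at [xi0]. Bounding the cosine by one makes this uniform in
    [lam]. *)
Lemma ghat_error (b q : R) (n : nat) (w : T) (lam : R) :
  `|ghat X tau wk b q n.+1 w lam -
    (2 * pi)^-1 * trig_sum (fun j => wk (j%:~R / b) *
       ((1 - (absz j)%:R / n.+1%:R) * r j)) n lam| <=
  (n.+1%:R^-1 * (2 * `|count_below X n.+1 w q - count_below X n.+1 w xi0|)) *
    \sum_(k < n.+1.*2.-1) `|wk ((k%:Z - (n.+1.-1)%:Z)%:~R / b)| +
  window_noise b n.+1 w.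
Proof.
rewrite ghatE -mulrBr normrM.
have p2 := @pi_ge2 R; have p0 : 0 < 2 * pi :> R by lra.
rewrite (gtr0_norm (_ : 0 < (2 * pi)^-1)) ?invr_gt0//.
apply: le_trans (ler_piMl (normr_ge0 _) _) _; first by rewrite invf_le1//; lra.
rewrite /trig_sum -sumrB; apply: le_trans (ler_norm_sum _ _ _) _.
rewrite /window_noise mulr_sumr -big_split /=; apply: ler_sum => k _.
set j := k%:Z - n%:Z; rewrite -mulrBl normrM.
apply: le_trans (ler_piMr (normr_ge0 _) (normr_cos_le1 _)) _.
rewrite -mulrBr normrM [X in _ <= X + _]mulrC -mulrDr ler_wpM2l//.
rewrite -(subrKA (rhat X tau xi0 n.+1 w j)); apply: le_trans (ler_normD _ _) _.
by rewrite lerD2r; exact: rhat_quantile_error.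
Qed.

Variables (delta C : R).
Hypothesis delta0 : 0 <= delta.
Hypothesis sumC : forall M, \sum_(m < M) dep_coef (P := P) eps eps0s Y xi0 delta m <= C.

Let C0 : 0 <= C. Proof. by have := sumC 0; rewrite big_ord0. Qed.

Lemma rhat_deviation n (j : int) : (0 < n)%N -> (absz j <= n)%N ->
  EP (fun w => `|rhat X tau xi0 n w j - (1 - (absz j)%:R / n%:R) * r j|) <=
  n%:R^-1 * (Num.sqrt n%:R * (4 * C)).
Proof.
move=> n0 jn; have nR : n%:R != 0 :> R by rewrite pnatr_eq0 -lt0n.
pose D w := \sum_((absz j).+1 <= t < n.+1)
  (Vt X tau xi0 t%:Z w * Vt X tau xi0 (t%:Z - (absz j)%:Z) w - r (absz j)%:Z).
have bD : bmf D.
  apply: bmf_sum => t; apply: bmfB; last exact: bmf_cst.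
  by apply: bmfM; exact: (@bmf_Vt_random (fun=> xi0)).
have -> : (fun w => `|rhat X tau xi0 n w j - (1 - (absz j)%:R / n%:R) * r j|) =
    fun w => n%:R^-1 * `|D w|.
  apply/funext => w; rewrite -[in RHS](ger0_norm (_ : 0 <= n%:R^-1)) ?invr_ge0//.
  rewrite -normrM; congr `|_|.
  rewrite /rhat /D sumrB sumr_const_nat subSS mulrBr; congr (_ - _).
  rewrite -(rtau_abs ie mY) -[r j *+ _]mulr_natl natrB//.
  by field.
rewrite expectRZ; last exact: bmf_norm.
rewrite ler_wpM2l ?invr_ge0//.
exact: (autocovariance_deviation ie mY delta0 sumC tau01).
Qed.

Lemma window_noise_mean (b : R) (n : nat) (K : R) : (0 < n)%N ->
  \sum_(k < n.*2.-1) `|wk ((k%:Z - (n.-1)%:Z)%:~R / b)| <= K ->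
  EP (window_noise b n) <= K * (n%:R^-1 * (Num.sqrt n%:R * (4 * C))).
Proof.
move=> n0 hK.
have bN (k : nat) : bmf (fun w => `|rhat X tau xi0 n w (k%:Z - (n.-1)%:Z) -
    (1 - (absz (k%:Z - (n.-1)%:Z))%:R / n%:R) * r (k%:Z - (n.-1)%:Z)|).
  by apply: bmf_norm; apply: bmfB; [exact: (@bmf_rhat (fun=> xi0))|exact: bmf_cst].
rewrite /window_noise expectR_sum; last by move=> k; exact: bmfZ.
have M0 : 0 <= n%:R^-1 * (Num.sqrt n%:R * (4 * C)).
  by rewrite !mulr_ge0 ?invr_ge0 ?sqrtr_ge0.
apply: le_trans (ler_wpM2r M0 hK); rewrite mulr_suml; apply: ler_sum => k _ /=.
rewrite expectRZ// ler_wpM2l//; apply: rhat_deviation => //.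
by have := ltn_ord k; lia.
Qed.

Definition cdf_noise (n : nat) (xi : R) (w : T) : R :=
  `|\sum_(1 <= t < n.+1) (@ind01 R (X t%:Z w < xi) - EP (fun w => @ind01 R (X 0 w < xi)))|.

Lemma bmf_cdf_noise n xi : bmf (cdf_noise n xi).
Proof.
apply: bmf_norm; apply: bmf_sum => t; apply: bmfB; last exact: bmf_cst.
exact: bmf_lt (measurable_Xproc ie mY _).
Qed.

Lemma cdf_noiseE n xi w : cdf_noise n xi w =
  `|count_below X n w xi - n%:R * EP (fun w => @ind01 R (X 0 w < xi))|.
Proof. by rewrite /cdf_noise sumrB sumr_const_nat subSS subn0 mulr_natl. Qed.

Hypothesis mean_tau : EP (fun w => @ind01 R (X 0 w < xi0)) = tau.

Lemma mean_Vt0 : EP (Vt X tau xi0 0) = 0.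
Proof.
rewrite /Vt expectRB ?expectR_cst ?mean_tau ?subrr//; first exact: bmf_cst.
exact: bmf_lt (measurable_Xproc ie mY _).
Qed.

(* [K] bounds the kernel sum divided by [b]; [y] is the lower barrier for the
   sample quantile. *)
Definition total_noise (K b : R) (n : nat) (y : R) (w : T) : R :=
  window_noise b n w + 2 * K * b * n%:R^-1 * (cdf_noise n xi0 w + cdf_noise n y w).

Lemma bmf_total_noise K b n y : bmf (total_noise K b n y).
Proof.
apply: bmfD; first exact: bmf_window_noise.
by apply: bmfZ; apply: bmfD; exact: bmf_cdf_noise.
Qed.

(** The window noise contributes [4 * K * C], each of the two empirical deviations [2 * K * C]. *)
Lemma total_noise_mean K b n y : (0 < n)%N -> 0 <= K -> 0 <= b -> `|xi0 - y| <= delta ->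
  \sum_(k < n.*2.-1) `|wk ((k%:Z - (n.-1)%:Z)%:~R / b)| <= K * b ->
  EP (total_noise K b n y) <= 8 * K * C * (b / Num.sqrt n%:R).
Proof.
move=> n0 K0 b0 yd hK.
have xd : `|xi0 - xi0| <= delta by rewrite subrr normr0.
rewrite /total_noise expectRD; [|exact: bmf_window_noise|
  by apply: bmfZ; apply: bmfD; exact: bmf_cdf_noise].
rewrite expectRZ; last by apply: bmfD; exact: bmf_cdf_noise.
rewrite expectRD; [|exact: bmf_cdf_noise|exact: bmf_cdf_noise].
have h1 := window_noise_mean n0 hK.
have h2 := empirical_cdf_deviation ie mY delta0 sumC n xd.
have h3 := empirical_cdf_deviation ie mY delta0 sumC n yd.
rewrite -!/(cdf_noise _ _ _) in h2 h3.
have nV : n%:R^-1 * Num.sqrt n%:R = (Num.sqrt n%:R)^-1 :> R.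
  have sn0 : Num.sqrt n%:R != 0 :> R by rewrite sqrtr_eq0 -ltNge ltr0n.
  by rewrite -{1}(sqr_sqrtr (ler0n R n)); field.
have Q0 : 0 <= 2 * K * b * n%:R^-1 by rewrite !mulr_ge0 ?invr_ge0.
have h4 : 2 * K * b * n%:R^-1 * (EP (cdf_noise n xi0) + EP (cdf_noise n y)) <=
    2 * K * b * n%:R^-1 * (Num.sqrt n%:R * C + Num.sqrt n%:R * C).
  by rewrite ler_wpM2l//; apply: lerD.
apply: (le_trans (lerD h1 h4)).
rewrite (_ : _ + _ = 8 * K * C * b * (n%:R^-1 * Num.sqrt n%:R)); last by ring.
by rewrite nV -!mulrA.
Qed.

(** The pathwise estimate when the noise is below [kappa]. The condition [kappa <= K * c * h * b]
    pushes the empirical fluctuation at [xi0 - h] below the gap [c * h], so the sample quantile lies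
    above the barrier. The term [2 * K * L * h * b] is the Lipschitz increment over [h], doubled by
    [rhat_quantile_error] and multiplied by the kernel sum. *)
Lemma ghat_error_le (K b c L h kappa : R) (n : nat) (w : T) (q lam : R) :
  1 <= K -> 1 <= b -> 0 < c -> 0 < h -> kappa <= K * c * h * b ->
  c * h <= tau - EP (fun w => @ind01 R (X 0 w < xi0 - h)) ->
  tau - EP (fun w => @ind01 R (X 0 w < xi0 - h)) <= L * h ->
  \sum_(k < n.+1.*2.-1) `|wk ((k%:Z - (n.+1.-1)%:Z)%:~R / b)| <= K * b ->
  is_sample_quantile X tau n.+1 w q ->
  total_noise K b n.+1 (xi0 - h) w < kappa ->
  `|ghat X tau wk b q n.+1 w lam -
    (2 * pi)^-1 * trig_sum (fun j => wk (j%:~R / b) *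
       ((1 - (absz j)%:R / n.+1%:R) * r j)) n lam| <= kappa + 2 * K * L * h * b.
Proof.
set p := EP _; move=> K1 b1 c0 h0 kap hc hL hK qq hw.
have n0 : 0 < n.+1%:R :> R by rewrite ltr0n.
have nV0 : 0 < n.+1%:R^-1 :> R by rewrite invr_gt0.
have K0 : 0 < K by lra.
have b0 : 0 < b by lra.
have Kb : 0 < K * b by exact: mulr_gt0.
have wn : 0 <= window_noise b n.+1 w by apply: sumr_ge0 => k _; rewrite mulr_ge0.
have cn1 : 0 <= cdf_noise n.+1 xi0 w by exact: normr_ge0.
have cn2 : 0 <= cdf_noise n.+1 (xi0 - h) w by exact: normr_ge0.
pose m := n.+1%:R^-1 : R.
pose a1 := m * cdf_noise n.+1 xi0 w; pose a2 := m * cdf_noise n.+1 (xi0 - h) w.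
have a10 : 0 <= a1 by rewrite mulr_ge0// ltW.
have a20 : 0 <= a2 by rewrite mulr_ge0// ltW.
have hw' : window_noise b n.+1 w + 2 * (K * b) * (a1 + a2) < kappa.
  by move: hw; rewrite /total_noise /a1 /a2 /m; set u := n.+1%:R^-1; congr (_ < _); ring.
have a2s : a2 < c * h.
  rewrite -(ltr_pM2l Kb); apply: lt_le_trans (_ : _ < kappa) _; first by nra.
  by apply: le_trans kap _; rewrite le_eqVlt; apply/orP; left; apply/eqP; ring.
have cnt2 : cdf_noise n.+1 (xi0 - h) w = n.+1%:R * a2.
  by rewrite /a2 /m mulVKf// gt_eqF.
have cnt1 : cdf_noise n.+1 xi0 w = n.+1%:R * a1.
  by rewrite /a1 /m mulVKf// gt_eqF.
rewrite cdf_noiseE -/p in cnt2; rewrite cdf_noiseE mean_tau in cnt1.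
have below_y : count_below X n.+1 w (xi0 - h) < n.+1%:R * tau.
  have := ler_norm (count_below X n.+1 w (xi0 - h) - n.+1%:R * p).
  by rewrite cnt2 => ?; nra.
have yx : xi0 - h <= xi0 by lra.
have := count_below_sample_quantile tau01 qq yx below_y.
rewrite cnt1 => hq.
have hy : `|count_below X n.+1 w (xi0 - h) - n.+1%:R * tau| <= n.+1%:R * (a2 + L * h).
  rewrite (_ : _ - _ = (count_below X n.+1 w (xi0 - h) - n.+1%:R * p) -
    n.+1%:R * (tau - p)); last by ring.
  apply: le_trans (ler_normB _ _) _.
  rewrite cnt2 [leRHS]mulrDr lerD2l normrM.
  rewrite (ger0_norm (ltW n0)) ler_pM2l// ger0_norm//.
  by apply: le_trans hc; rewrite mulr_ge0// ltW.
apply: le_trans (ghat_error b q n w lam) _.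
set D := `|count_below X n.+1 w q - _| in hq *.
have D0 : 0 <= D by exact: normr_ge0.
have mD : m * D <= a1 + a2 + L * h.
  by rewrite /m mulrC ler_pdivrMr//; lra.
have m0 : 0 <= m * (2 * D) by rewrite !mulr_ge0// ltW.
have := ler_wpM2l m0 hK; rewrite -/m => h5.
have h6 : m * (2 * D) * (K * b) <= 2 * (K * b) * (a1 + a2 + L * h).
  by rewrite (_ : _ * (K * b) = 2 * (K * b) * (m * D)) ?ler_pM2l//; [lra|ring].
have -> : 2 * K * L * h * b = 2 * (K * b) * (L * h) by ring.
lra.
Qed.

End SpectralEstimator.

(** * Uniform consistency: choice of constants and passage to the limit *)

Unset Implicit Arguments.

Theorem theorem3p6
  (R : realType) (d : measure_display) (T : measurableType d)
  (P : probability T R) (dE : measure_display) (E : measurableType dE)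
  (eps : int -> T -> E) (eps0s : T -> E) (Y : (nat -> E) -> R)
  (tau : R) (wk : R -> R) (B : nat -> R) (xihat : nat -> T -> R) :
  (* (eps_t)_{t in Z} i.i.d., eps_0^* an independent copy of eps_0 *)
  (forall o, measurable_fun setT (ext_family eps eps0s o)) ->
  mutually_independent P (ext_family eps eps0s) ->
  identically_distributed P (ext_family eps eps0s) ->
  (* Y measurable *)
  seq_measurable Y ->
  let X := Xproc Y eps in
  let F := cdfX P (X 0) in
  let xi0 := quantile0 F tau in
  0 < tau < 1 ->
  (* (B) *)
  (exists eta L : R, 0 < eta /\ forall x y : R,
      `|x - xi0| < eta -> `|y - xi0| < eta -> `|F x - F y| <= L * `|x - y|) ->
  (exists (f : R -> R) (eta : R), 0 < eta /\
      (@lebesgue_measure R).-integrable [set y | xi0 - eta <= y <= xi0 + eta]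
         (fun y => (f y)%:E) /\
      (forall x : R, xi0 - eta <= x <= xi0 + eta ->
         F x - F (xi0 - eta) =
         Rintegral (@lebesgue_measure R) [set y | xi0 - eta <= y <= x] f) /\
      {for xi0, continuous f} /\ 0 < f xi0) ->
  (* (C) *)
  (exists delta : R, 0 < delta /\
     (\sum_(0 <= t <oo)
        (sup [set L2nrm P (fun w => @ind01 R (X t%:Z w < xi)
                                   - @ind01 R (Xstar Y eps eps0s t w < xi))
             | xi in [set xi | `|xi0 - xi| <= delta]])%R%:E < +oo)%E) ->
  (* kernel and bandwidth *)
  in_W wk ->
  B @ \oo --> +oo ->
  (fun n => B n / Num.sqrt n%:R) @ \oo --> 0 ->
  (* hat xi_n(tau): any (measurable) minimizer of the check loss *)
  (forall n, measurable_fun setT (xihat n)) ->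
  (forall n w, is_sample_quantile X tau n w (xihat n w)) ->
  (* uniform consistency in probability *)
  forall eta : R, 0 < eta ->
    (fun n => P [set w | eta < sup [set `|ghat X tau wk (B n) (xihat n w) n w lam
                                        - gtau (rtau P X tau xi0) lam|
                                     | lam in [set lam | - pi < lam <= pi]]])
      @ \oo --> 0%E.
Proof.
move=> me ind_e id_e mY X F xi0 tau01 [eta1 [L [eta10 lipF]]].
move=> [f [eta2 [eta20 [intf [densF [contf f0]]]]]].
move=> [delta [delta0 sumD]] [[A wA] [cw [we [w0 [wint _]]]]] Boo Bn mxi qxi eta eta0.
have ie : iid (P := P) (ext_family eps eps0s) by split.
have mX0 : measurable_fun setT (X 0) := measurable_Xproc ie mY 0.
have d0 : 0 <= delta := ltW delta0.
have [C sumC] := dep_coef_partial_sums ie mY d0 sumD.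
have L0 : 0 <= L := lipschitz_ge0 eta10 lipF.
have Ftau : F xi0 = tau := cdfX_quantile mX0 tau01 eta10 lipF.
have meanE x : `|x - xi0| < eta1 -> expectR P (fun w => @ind01 R (X 0 w < x)) = F x :=
  expectR_lt mX0 eta10 lipF (x := x).
have mean_tau : expectR P (fun w => @ind01 R (X 0 w < xi0)) = tau.
  by rewrite meanE ?Ftau// subrr normr0.
have [c [h0 [c0 h00 hdens]]] := density_lower_bound eta20 intf densF contf f0.
have mean0 := mean_Vt0 ie mY mean_tau.
pose r := rtau P X tau xi0.
have r_even j : r j = r (absz j)%:Z := rtau_abs ie mY xi0 tau j.
have r_sum J : \sum_(j < J) `|r j%:Z| <= C ^+ 2 :=
  rtau_partial_sums ie mY d0 sumC tau01 mean0 J.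
have [K [K1 hK]] := kernel_sum_le wA wint we.
have C0 : 0 <= C by have := sumC 0%N; rewrite big_ord0.
have K0 : 0 < K by lra.
have KL : 0 < 8 * K * (L + 1) by apply: mulr_gt0; lra.
(* With the barrier at distance [th / B n] the Lipschitz error is [2 * K * L * th], at most
   [eta / 4]; [L + 1] keeps the denominator positive. *)
pose th := eta / (8 * K * (L + 1)).
have th0 : 0 < th by exact: divr_gt0.
have thE : 8 * K * (L + 1) * th = eta by rewrite /th mulrC divfK// gt_eqF.
have thL : 2 * K * L * th <= eta / 4 by nra.
(* Noise, barrier and bias get [eta / 4] each. The second bound is [K * c * h * B n] at
   [h = th / B n]. *)
pose kappa := Num.min (eta / 4) (K * c * th).
have kappa0 : 0 < kappa.
  by rewrite lt_min (divr_gt0 eta0 (ltr0n R 4)) (mulr_gt0 (mulr_gt0 K0 c0) th0).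
have [n1 bias] := lag_window_bias r_even r_sum wA cw we w0 Boo (divr_gt0 eta0 (ltr0n R 4)).
(* The barrier must stay where the density bound, the Lipschitz bound and (C) apply; the half gives
   a distance strictly below [eta1]. *)
pose hmax := Num.min (Num.min h0 (eta1 / 2)) delta.
have hmax0 : 0 < hmax by rewrite !lt_min h00 delta0 (divr_gt0 eta10 (ltr0n R 2)).
pose ev n := [set w | eta < sup [set `|ghat X tau wk (B n) (xihat n w) n w lam - gtau r lam|
    | lam in [set lam | - pi < lam <= pi]]].
have cg : continuous (gtau r) := @continuous_gtau _ _ _ r_even r_sum.
have cgh n w : continuous (fun lam => ghat X tau wk (B n) (xihat n w) n w lam).
  case: n => [|n] lam.
    rewrite (_ : (fun _ => _) = cst 0); first exact: cvg_cst.
    by apply/funext => l; rewrite /ghat big_ord0 mulr0.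
  pose cc j := wk (j%:~R / B n.+1) * rhat X tau (xihat n.+1 w) n.+1 w j.
  by apply: cvgM; [exact: cvg_cst|exact: (@continuous_trig_sum _ cc n lam)].
have mev n : measurable (ev n).
  apply: (measurable_sup_gt (h := fun w lam =>
    ghat X tau wk (B n) (xihat n w) n w lam - gtau r lam)).
  - by have := @pi_ge2 R; lra.
  - move=> lam; have := bmfB (bmf_ghat ie mY tau wk (B n) n lam (mxi n)) (bmf_cst (gtau r lam)).
    by case.
  - move=> w lam; exact: (cvgB (cgh n w lam) (cg lam)).
  - move=> w; have [M hM] := gtau_bounded r_even r_sum.
    case: n => [|n].
      by exists M => l; rewrite /ghat big_ord0 mulr0 sub0r normrN.
    pose cc j := wk (j%:~R / B n.+1) * rhat X tau (xihat n.+1 w) n.+1 w j.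
    exists (`|(2 * pi)^-1| * \sum_(k < n.*2.+1) `|cc (k%:Z - n%:Z)| + M) => l.
    apply: le_trans (ler_normB _ _) _; apply: lerD => //.
    by rewrite ghatE normrM ler_wpM2l//; exact: trig_sum_norm.
(* Where the total noise is below [kappa] the three contributions keep the supremum below [eta];
   Markov's inequality bounds the probability of the rest. *)
have bound n : (n1 <= n)%N -> 1 <= B n.+1 -> th / B n.+1 <= hmax ->
    (P (ev n.+1) <= (8 * K * C / kappa * (B n.+1 / Num.sqrt n.+1%:R))%:E)%E.
  move=> n1n b1; set b := B n.+1 in b1 *; set h := th / b; rewrite !le_min.
  move=> /andP[/andP[hh0 hh1] hhd].
  have b0 : 0 < b by lra.
  have hp : 0 < h by exact: divr_gt0.
  have hb : h * b = th by rewrite /h divfK// gt_eqF.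
  have hK' := hK b n.+1 b1.
  have yd : `|xi0 - (xi0 - h)| <= delta by rewrite (_ : _ - _ = h) ?gtr0_norm//; ring.
  have ye : `|xi0 - h - xi0| < eta1.
    by rewrite (_ : _ - _ = - h) ?normrN ?gtr0_norm//; [lra|ring].
  have xe : `|xi0 - xi0| < eta1 by rewrite subrr normr0.
  have hc : c * h <= tau - expectR P (fun w => @ind01 R (X 0 w < xi0 - h)).
    by rewrite meanE// -Ftau; exact: hdens.
  have hL : tau - expectR P (fun w => @ind01 R (X 0 w < xi0 - h)) <= L * h.
    rewrite meanE// -Ftau; have := lipF _ _ xe ye.
    rewrite (_ : xi0 - (xi0 - h) = h); last by ring.
    by rewrite (gtr0_norm hp); apply: le_trans; exact: ler_norm.
  pose H := total_noise (P := P) eps Y tau wk xi0 K b n.+1 (xi0 - h).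
  have bH : bmf H := bmf_total_noise ie mY tau wk xi0 K b n.+1 (xi0 - h).
  have HE : expectR P H <=
      8 * K * C * (b / Num.sqrt n.+1%:R).
    by apply: (total_noise_mean ie mY tau01 d0 sumC) => //; exact: ltW.
  have H0 w : 0 <= H w.
    apply: addr_ge0; first by apply: sumr_ge0 => k _; rewrite mulr_ge0.
    by rewrite !mulr_ge0 ?invr_ge0 ?addr_ge0 ?normr_ge0//; lra.
  apply: (@le_trans _ _ ((8 * K * C * (b / Num.sqrt n.+1%:R)) / kappa)%:E); last first.
    by rewrite lee_fin le_eqVlt; apply/orP; left; apply/eqP; ring.
  apply: (@le_trans _ _ (P [set w | kappa <= H w])); last first.
    apply: le_trans (markov_expectR (P := P) bH H0 kappa0) _.
    by rewrite lee_fin ler_pM2r// invr_gt0.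
  apply: le_measure; rewrite ?inE//.
    rewrite (_ : [set w | _] = H @^-1` `[kappa, +oo[).
      by rewrite -[X in measurable X]setTI; case: bH => mH _; exact: mH.
    by apply/seteqP; split => w /=; rewrite in_itv /= andbT.
  move=> w /= hsup; rewrite leNgt; apply/negP => hw.
  move: hsup; apply/negP; rewrite -leNgt; apply: sup_le_ub.
    by exists `|ghat X tau wk b (xihat n.+1 w) n.+1 w pi - gtau r pi|, pi => //=;
      rewrite lexx andbT; have := @pi_ge2 R; lra.
  move=> _ [lam _ <-].
  have kap : kappa <= K * c * h * b by rewrite -mulrA hb ge_min lexx orbT.
  have E1 := ghat_error_le tau01 mean_tau lam K1 b1 c0 hp kap hc hL hK' (qxi n.+1 w) hw.
  have E2 := bias n n1n lam; rewrite -/b in E2.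
  have kap4 : kappa <= eta / 4 by rewrite ge_min lexx.
  have E3 : 2 * K * L * h * b <= eta / 4 by rewrite -mulrA hb.
  set G := ghat _ _ _ _ _ _ _ _ in E1 *; set Q := (2 * pi)^-1 * _ in E1 E2.
  rewrite (_ : G - _ = (G - Q) + (Q - gtau r lam)); last by ring.
  apply: le_trans (ler_normD _ _) _; lra.
have up : (fun n => (8 * K * C / kappa * (B n / Num.sqrt n%:R))%:E) @ \oo --> 0%E.
  apply: cvg_EFin; first by near=> n.
  rewrite -[X in _ --> X](mulr0 (8 * K * C / kappa)).
  by apply: cvgM; [exact: cvg_cst|exact: Bn].
apply: (squeeze_cvge _ (cvg_cst 0%E) up).
have ev1 : \forall n \near \oo, 1 <= B n by move/cvgryPge : Boo => /(_ 1).
have ev2 : \forall n \near \oo, th / hmax <= B n by move/cvgryPge : Boo => /(_ (th / hmax)).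
move: ev1 ev2 => [m1 _ h1] [m2 _ h2].
exists (maxn n1.+1 (maxn m1 m2)) => // -[|n] /=; first by rewrite geq_max.
rewrite !geq_max => /andP[n1n /andP[m1n m2n]].
rewrite measure_ge0 /=; have b1 : 1 <= B n.+1 by exact: h1.
apply: bound => //.
rewrite ler_pdivrMr ?(lt_le_trans ltr01)// mulrC -ler_pdivrMr//; exact: h2.
Unshelve. all: by end_near.
Qed.
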